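(* Let $d\mu(x)=e^{-V(x)}dx$ be a probability measure on $\mathbb R^d$ such that $\int_{\mathbb R^d}e^{\eta|x|^\alpha}d\mu(x)<+\infty$ for some $\eta>0$, $\alpha\in(1,2]$. a) Assume that $V$ is continuously differentiable, that there exist $C_1,C_2\in\mathbb R$ and $\varepsilon>0$ such that $$V(x)\le C_1\langle x,\nabla V(x)\rangle+C_2\ \ (x\in\mathbb R^d),\qquad\exp\left(\varepsilon|\nabla V|\log^{\frac1\alpha}|\nabla V|\right)\in L^1(\mu),$$ and that $-V\le g$ for some $g\in L^1(\mu)$. Then $\mu$ satisfies Inequality $I(2/\alpha^* )$. b) Assume that $\alpha=2$, that $V$ is twice continuously differentiable, that $-V\le g$ for some $g\in L^1(\mu)$, and that there exist $s_0>0$ and $t\in(0,1)$ such that for every $0<s<s_0$ there exists $C=C(s,t)$ satisfying $$sV\le(1-t)|\nabla V|^2-\Delta V+C.$$ Then $\mu$ satisfies the defective log-Sobolev inequality: there are constants $B',C'$ such that $\mathrm{Ent}_\mu(f^2)\le C'\int|\nabla f|^2d\mu+B'\int f^2d\mu$ for all smooth $f$. In particular, this conclusion holds (with $\alpha=2$, $V$ twice continuously differentiable) if $V$ is bounded from below and $sV\le(1-t)|\nabla V|^2-\Delta V+C$ for some $s>0$, $0<t<1$ and some constant $C$.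
   Context: $\frac1\alpha+\frac1{\alpha^*}=1$. $\mathrm{Ent}_\mu(f^2)=\int f^2\log\left(f^2/\int f^2d\mu\right)d\mu$. For $\tau\in(0,1]$, $\mu$ satisfies Inequality $I(\tau)$ if there exist constants $B,C$ such that for every smooth $f$, $\mathrm{Ent}_\mu(f^2)\le B\int f^2d\mu+C\int|\nabla f|^2\log^{1-\tau}\left(e+\frac{f^2}{\int f^2d\mu}\right)d\mu$. The quantity $\log^{1/\alpha}|\nabla V|$ is understood as $0$ where $|\nabla V|\le1$. *)

(* Defs.v *)
From HB Require Import structures.
From mathcomp Require Import all_boot all_order all_algebra.
From mathcomp Require Import all_classical all_reals all_analysis.

Set Implicit Arguments.
Unset Strict Implicit.
Unset Printing Implicit Defensive.

Import Order.TTheory GRing.Theory Num.Theory.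
Import numFieldNormedType.Exports.

Local Open Scope classical_set_scope.
Local Open Scope ring_scope.

(* The sigma-algebra on R^n is the one generated by the coordinates, as for   *)
(* the library's [n.-tuple T]; R being second countable, it is the Borel      *)
(* sigma-algebra.                                                             *)
Section measurable_rV.
Context (R : realType) (n : nat).

Let coord : 'I_n -> 'rV[R]_n -> R := fun i x => x ord0 i.

Let rV_set0 : g_sigma_preimage coord set0.
Proof. exact: sigma_algebra0. Qed.

Let rV_setC A : g_sigma_preimage coord A -> g_sigma_preimage coord (~` A).
Proof. exact: sigma_algebraC. Qed.

Let rV_bigcup (F : (set 'rV[R]_n)^nat) :
  (forall i, g_sigma_preimage coord (F i)) ->
  g_sigma_preimage coord (\bigcup_i (F i)).
Proof. exact: sigma_algebra_bigcup. Qed.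

HB.instance Definition _ := @isMeasurable.Build default_measure_display
  'rV[R]_n (g_sigma_preimage coord) rV_set0 rV_setC rV_bigcup.

End measurable_rV.

Section lebesgue_rV.
Context (R : realType).

Lemma measurable_fun_rV d (T : measurableType d) n (f : T -> 'rV[R]_n) :
  (forall i, measurable_fun [set: T] (fun x => f x ord0 i)) ->
  measurable_fun [set: T] f.
Proof.
move=> mf _ A; rewrite setTI; move: A.
suff : @measurable _ 'rV[R]_n `<=` [set A | measurable (f @^-1` A)] by [].
apply: smallest_sub.
  split=> [|A mA|F mF] /=; first by rewrite preimage_set0.
    by rewrite setTD -preimage_setC; exact: measurableC.
  by rewrite preimage_bigcup; apply: bigcup_measurable => k _; exact: mF.
rewrite -bigcup_seq/=; apply: bigcup_sub => i _ _ [B mB <-] /=.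
by rewrite setTI -comp_preimage -[X in measurable X]setTI; exact: mf.
Qed.

Lemma measurable_coord n (i : 'I_n) :
  measurable_fun [set: 'rV[R]_n] (fun x : 'rV[R]_n => x ord0 i).
Proof.
move=> _ Y mY; rewrite setTI; apply: sub_sigma_algebra => /=.
rewrite -bigcup_seq/=; exists i => /=; first by rewrite mem_index_enum.
by exists Y => //; rewrite setTI.
Qed.

Definition rV_rcons n (p : 'rV[R]_n * measurableTypeR R) : 'rV[R]_n.+1 :=
  \row_i (if unlift ord_max i is Some j then p.1 ord0 j else p.2).

Lemma measurable_rV_rcons n : measurable_fun setT (@rV_rcons n).
Proof.
apply: measurable_fun_rV => i.
under eq_fun do rewrite mxE.
case: unlift => [j|]; last exact: measurable_snd.
exact: (measurableT_comp (@measurable_coord n j) measurable_fst).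
Qed.

Section extend.
Context (n : nat).
Variable m : {measure set 'rV[R]_n -> \bar R}.

Definition lebesgue_extend : set 'rV[R]_n.+1 -> \bar R :=
  pushforward (m \x lebesgue_measure)%E (@rV_rcons n).

Let extend0 : lebesgue_extend set0 = 0%E.
Proof. by rewrite /lebesgue_extend /pushforward preimage_set0 measure0. Qed.

Let extend_ge0 A : (0 <= lebesgue_extend A)%E.
Proof. exact: (measure_ge0 (m \x lebesgue_measure)%E). Qed.

Let extend_sigma_additive : semi_sigma_additive lebesgue_extend.
Proof.
apply: (@measure_semi_sigma_additive _ _ _ (pushforward _ _)).
exact: measurable_rV_rcons.
Qed.

HB.instance Definition _ := isMeasure.Build _ _ _ lebesgue_extend
  extend0 extend_ge0 extend_sigma_additive.

End extend.

(* Lebesgue measure on R^n, as the n-fold product of [lebesgue_measure]. *)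
Fixpoint lebesgue_rV n : {measure set 'rV[R]_n -> \bar R} :=
  match n with
  | 0 => dirac (0 : 'rV[R]_0)
  | n'.+1 => lebesgue_extend (lebesgue_rV n')
  end.

Lemma lebesgue_rV_box n (B : 'I_n -> set R) :
  (forall i, measurable (B i)) ->
  lebesgue_rV n [set x | forall i, B i (x ord0 i)] =
  (\prod_(i < n) lebesgue_measure (B i))%E.
Proof.
elim: n B => [|n IH] B mB.
  by rewrite big_ord0 /= diracE mem_set//= => -[].
have mbox : measurable [set x : 'rV[R]_n |
    forall i, B (lift ord_max i) (x ord0 i)].
  rewrite (_ : mkset _ = \big[setI/setT]_i
      ((fun x : 'rV[R]_n => x ord0 i) @^-1` B (lift ord_max i))).
    apply: bigsetI_measurable => i _.
    by rewrite -[X in measurable X]setTI; exact: measurable_coord.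
  by rewrite -bigcap_seq; apply/seteqP; split => x /= h i *; apply: h => //=; rewrite mem_index_enum.
rewrite big_ord_recr/= /lebesgue_extend /pushforward.
rewrite (_ : _ @^-1` _ = [set x : 'rV[R]_n |
    forall i, B (lift ord_max i) (x ord0 i)] `*` B ord_max); last first.
  apply/seteqP; split=> [[x r]/= h|[x r]/= [h hr] i].
    split=> [i|]; [have := h (lift ord_max i)|have := h ord_max].
      by rewrite mxE liftK.
    by rewrite mxE unlift_none.
  by rewrite mxE; case: unliftP => [j|] ->.
rewrite product_measure1E//; last exact: mB.
have := IH (fun i => B (lift ord_max i)) (fun i => mB _).
rewrite /= => ->; congr (_ * _)%E.
apply: eq_bigr => i _; congr (lebesgue_measure (B _)); apply/val_inj.
by rewrite /= /bump leqNgt ltn_ord.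
Qed.

End lebesgue_rV.

Section calculus_rV.
Context (R : realType) (d : nat).
Implicit Types (f : 'rV[R]_d -> R) (x y : 'rV[R]_d).

Definition dotp x y : R := \sum_i x ord0 i * y ord0 i.

(* The library's norm on 'rV[R]_d is the sup norm. *)
Definition enorm x : R := Num.sqrt (dotp x x).

Definition partial (i : 'I_d) f : 'rV[R]_d -> R := 'D_(delta_mx ord0 i) f.

Definition grad f x : 'rV[R]_d := \row_i partial i f x.

Definition laplacian f x : R := \sum_i partial i (partial i f) x.

Fixpoint Ck (k : nat) f : Prop :=
  match k with
  | 0 => continuous f
  | k'.+1 => (forall x, differentiable f x) /\ forall i, Ck k' (partial i f)
  end.

Definition smooth f : Prop := forall k, Ck k f.

End calculus_rV.

Section inequalities.
Context (R : realType) (d : nat).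
Variable mu : {measure set 'rV[R]_d -> \bar R}.

(* For g >= 0 integrable; the conventions ln 0 = 0 and x / 0 = 0 give         *)
(* 0 log 0 = 0 and Ent 0 = 0.                                                 *)
Definition Ent (g : 'rV[R]_d -> R) : \bar R :=
  (\int[mu]_x (g x * ln (g x / (\int[mu]_y g y)%R))%:E)%E.

(* The functional inequalities range over the smooth f with f ^ 2 integrable, *)
(* for which Ent (f ^ 2) makes sense; the gradient terms may be infinite.     *)
Definition admissible (f : 'rV[R]_d -> R) : Prop :=
  smooth f /\ mu.-integrable setT (fun x => (f x ^+ 2)%:E).

Definition inequality_I (tau : R) : Prop :=
  exists B C : R, forall f, admissible f ->
  (Ent (fun x => f x ^+ 2)%R <=
   B%:E * \int[mu]_x (f x ^+ 2)%:E +
   C%:E * \int[mu]_x (enorm (grad f x) ^+ 2 *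
     ln (expR 1 + f x ^+ 2 / (\int[mu]_y (f y ^+ 2))%R) `^ (1 - tau))%:E)%E.

Definition defective_log_sobolev : Prop :=
  exists C' B' : R, forall f, admissible f ->
  (Ent (fun x => f x ^+ 2)%R <=
   C'%:E * \int[mu]_x (enorm (grad f x) ^+ 2)%:E +
   B'%:E * \int[mu]_x (f x ^+ 2)%:E)%E.

End inequalities.

(* log^a y, read as 0 for y <= 1 (where [ln y `^ a] need not vanish).         *)
Definition logpow (R : realType) (a y : R) : R :=
  if 1 < y then ln y `^ a else 0.

(* Main.v *)
Require Import Defs.
From HB Require Import structures.
From mathcomp Require Import all_boot all_order all_algebra.
From mathcomp Require Import all_classical all_reals all_analysis.
From mathcomp Require Import measurable_realfun ring lra.
Import Order.TTheory GRing.Theory Num.Theory.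
Import numFieldNormedType.Exports.
Local Open Scope classical_set_scope.
Local Open Scope ring_scope.
Set Implicit Arguments.
Unset Strict Implicit.
Unset Printing Implicit Defensive.

(* Let u = w e^(-V) with w = theta F^2, theta a C^1 cutoff and int F^2 dmu <= 1.
   Since int w ln w dmu = int u ln u dx + int w V dmu, the theorem splits in two.
   - The Lebesgue entropy is controlled by gradients in L^1: on a line u is at
     most int |d_i u|, so integrating out one coordinate at a time and using
     ln y <= delta y - ln delta gives
       int u ln u <= delta sum_i int |d_i u| + C(delta),
     and |d_i u| e^V <= |d_i w| + w |d_i V|.
   - The potential term is integrated by parts against a field X, namely
     int div (w X e^(-V)) dx = 0.  In a), X = C1 x removes <x, grad V> and leaves
     w + <x, grad w>; Young's inequality for the entropy absorbs |x|^2 and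
     |grad V| thanks to the two exponential moments.  In b), X = grad V / s
     produces a negative multiple of w |grad V|^2, which pays for the gradient
     of V in the first point.
   Everything reduces to one pointwise inequality; the cutoff is then removed by
   Fatou's lemma. *)

(** * Measurability on row vectors *)

(** The Lebesgue entropy bound is linear in the gradient of u, so the gradient of V enters it to the
    first power; this is why an exponential moment of |grad V| is enough in a). Its constant [delta]
    is free and costs only d |ln delta|, because the mass of u is at most 1. It is taken small
    enough for the gradient term to be absorbed: in b) by half of what the field leaves of w |grad
    V|^2, in a) by a quarter of the entropy. Another quarter pays for |x|^2 in a), so half of the
    entropy survives there, and all of it in b). In a), <x, grad w> is split by a weighted Young
    inequality into F^2 |x|^2 / L and |grad F|^2 L with L = log^(1 - tau)(e + F^2): this is where
    the weight of I(tau) comes from. The cutoff must not spoil these absorptions as its radius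
    grows. It is a square, so its slopes g satisfy g^2 <= 16 theta uniformly in the radius, and in
    b) the errors g F^2 d_i V are again controlled by theta F^2 (d_i V)^2 and F^2. *)

Section measurability_rV.
Context (R : realType) (n : nat).

(** Boxes with rational centre and radius 1/(k+1) form a countable basis, and each is a finite
    intersection of preimages under coordinates. *)
Lemma open_measurable_rV (U : set 'rV[R]_n) : open U -> measurable U.
Proof.
move=> oU.
pose B (p : 'rV[rat]_n * nat) : set 'rV[R]_n :=
  [set y | forall i, `|y ord0 i - ratr (p.1 ord0 i)| < p.2.+1%:R^-1].
have mB p : measurable (B p).
  rewrite (_ : B p = \big[setI/setT]_i ((fun x : 'rV[R]_n => x ord0 i) @^-1`
      [set r | `|r - ratr (p.1 ord0 i)| < p.2.+1%:R^-1])).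
    apply: bigsetI_measurable => i _; rewrite -[X in measurable X]setTI.
    apply: (@measurable_coord R n i) => //.
    rewrite (_ : mkset _ = ball (ratr (p.1 ord0 i) : R) p.2.+1%:R^-1).
      apply: open_measurable; exact: ball_open.
    by apply/seteqP; split => r; rewrite /ball/= distrC.
  by rewrite -bigcap_seq; apply/seteqP; split => x /= h i *; apply: h => //=;
    rewrite mem_index_enum.
rewrite (_ : U = \bigcup_p (if `[< B p `<=` U >] then B p else set0)).
  apply: (countable_bigcupT_measurable (countableP _)) => p.
  by case: ifP.
apply/seteqP; split => [x Ux|x [p _]]; last first.
  by case: ifP => // /asboolP h /h.
have /nbhs_ballP[e /= e0 eU] : nbhs x U by exact: open_nbhs_nbhs.
(* One radius leads from [x] to the rational centre, a second one from the centre to any point of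
   the box. *)
have [k ke] : exists k : nat, 2 * k.+1%:R^-1 < e.
  have e2 : 0 < e / 2 by rewrite divr_gt0.
  by have [k] := ltr_add_invr e2; rewrite add0r => kp; exists k; rewrite mulrC -ltr_pdivlMr.
have k0 : 0 < k.+1%:R^-1 :> R by rewrite invr_gt0.
have dense (r z : R) : 0 < z -> exists q : rat, `|r - ratr q| < z.
  move=> z0; have [q] := @rat_in_itvoo R (r - z) (r + z) ltac:(lra).
  rewrite in_itv/= => /andP[q1 q2]; exists q.
  by rewrite ltr_norml; apply/andP; split; lra.
have /choice[q qP] : forall i : 'I_n, exists q : rat,
    `|x ord0 i - ratr q| < k.+1%:R^-1.
  by move=> i; exact: dense.
exists (\row_i q i, k) => //=.
have -> : `[< B (\row_i q i, k) `<=` U >].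
  apply/asboolP => y By; apply: eU; split=> // i j /=; rewrite (ord1 i).
  have := By j; have := qP j; rewrite mxE => h1 h2.
  rewrite -ball_normE/= -(subrK (ratr (q j)) (x ord0 j)) -addrA.
  apply: (le_lt_trans (ler_normD _ _)); rewrite [X in _ + X]distrC.
  by apply: lt_trans ke; rewrite mulrDl mul1r; exact: ltrD.
by move=> i; rewrite mxE; exact: qP.
Qed.

Lemma continuous_measurable_rV (f : 'rV[R]_n -> R) :
  continuous f -> measurable_fun setT f.
Proof.
move=> /continuousP cf; apply: (measurability _ (RGenOpens.measurableE R)).
move=> _ [_ [a [b ->] <-]]; rewrite setTI.
by apply: open_measurable_rV; exact/cf/interval_open.
Qed.

End measurability_rV.

(** * Sigma-finiteness of Lebesgue measure *)

Section sigma_finite_rV.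
Context (R : realType) (n : nat).

Definition box (K : R) : set 'rV[R]_n :=
  [set x | forall i, `[- K, K]%classic (x ord0 i)].

Lemma measurable_box K : measurable (box K).
Proof.
rewrite (_ : box K = \big[setI/setT]_i ((fun x : 'rV[R]_n => x ord0 i) @^-1`
    `[- K, K]%classic)).
  apply: bigsetI_measurable => i _; rewrite -[X in measurable X]setTI.
  exact: (@measurable_coord R n i).
by rewrite -bigcap_seq; apply/seteqP; split => x /= h i *; apply: h => //=;
  rewrite mem_index_enum.
Qed.

Lemma lebesgue_rV_box_lty K : (lebesgue_rV R n (box K) < +oo)%E.
Proof.
have -> := @lebesgue_rV_box R n (fun=> `[- K, K]%classic) (fun=> measurable_itv _).
rewrite ltey_eq; apply/orP; left.
elim/big_ind : _ => // [x y|i _]; first exact: fin_numM.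
by rewrite lebesgue_measure_itv/=; case: ifP.
Qed.

Lemma box_cover : \bigcup_k box k%:R = [set: 'rV[R]_n].
Proof.
apply/seteqP; split=> // x _.
exists (\max_(i < n) (Num.bound `|x ord0 i|))%N => // i.
have h : `|x ord0 i| < (Num.bound `|x ord0 i|)%:R by exact: archi_boundP.
rewrite /= in_itv/= -ler_norml (le_trans (ltW h))// ler_nat.
exact: (@leq_bigmax _ (fun i => Num.bound `|x ord0 i|) i).
Qed.

(* An alias of [lebesgue_rV R n] carrying the sigma-finite structure that the *)
(* Fubini theorems of the library expect.                                     *)
Definition leb : set 'rV[R]_n -> \bar R := lebesgue_rV R n.

HB.instance Definition _ := Measure.copy leb (lebesgue_rV R n).

Let leb_sigma_finite : sigma_finite setT leb.
Proof.
exists (fun k => box k%:R); first by rewrite box_cover.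
by move=> k; split; [exact: measurable_box|exact: lebesgue_rV_box_lty].
Qed.

HB.instance Definition _ := @Measure_isSigmaFinite.Build _ _ _ leb leb_sigma_finite.

End sigma_finite_rV.

(** * Fubini for bounded functions supported in a box *)

Section bounded_finite_support.
Context d (T : measurableType d) (R : realType).
Variable m : {measure set T -> \bar R}.

Lemma bounded_support_integrable (f : T -> R) (A : R) (B : set T) :
  measurable_fun setT f -> measurable B -> (m B < +oo)%E ->
  (forall x, `|f x| <= A * \1_B x) -> m.-integrable setT (EFin \o f).
Proof.
move=> mf mB Boo fA.
have mI : measurable_fun setT (fun x => `|A| * \1_B x : R).
  by apply: measurable_funM => //; exact: measurable_indic.
apply: (@le_integrable _ _ _ m setT _ _ (EFin \o (fun x => `|A| * \1_B x))) => //.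
- exact/measurable_EFinP.
- move=> x _; rewrite /= lee_fin (le_trans (fA x))//.
  rewrite [leRHS]ger0_norm ?mulr_ge0//.
  by rewrite ler_wpM2r ?ler_norm.
- apply/integrableP; split; first exact/measurable_EFinP.
  under eq_integral.
    move=> x _; rewrite gee0_abs/=; last by rewrite lee_fin mulr_ge0.
    rewrite EFinM; over.
  rewrite ge0_integralZl//.
    by rewrite integral_indic// setIT lte_mul_pinfty.
  by apply/measurable_EFinP; exact: measurable_indic.
Qed.

End bounded_finite_support.

Section fubini_bounded.
Context d1 d2 (T1 : measurableType d1) (T2 : measurableType d2) (R : realType).
Variables (m1 : {sigma_finite_measure set T1 -> \bar R})
          (m2 : {sigma_finite_measure set T2 -> \bar R}).
Variables (g : T1 * T2 -> R) (A : R) (B1 : set T1) (B2 : set T2).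
Hypotheses (mg : measurable_fun setT g) (mB1 : measurable B1)
  (mB2 : measurable B2) (B1oo : (m1 B1 < +oo)%E) (B2oo : (m2 B2 < +oo)%E)
  (gA : forall x y, `|g (x, y)| <= A * \1_B1 x * \1_B2 y).

Let mgx x : measurable_fun setT (fun y => g (x, y)).
Proof. exact: measurableT_comp. Qed.

Let mgy y : measurable_fun setT (fun x => g (x, y)).
Proof. exact: measurableT_comp. Qed.

(** The domination holds at every [x], so every slice is integrable, not merely almost every one,
    and real-valued integrals can be iterated without exceptional sets. *)
Lemma slice1_integrable x : m2.-integrable setT (fun y => (g (x, y))%:E).
Proof. exact: (@bounded_support_integrable _ _ _ _ _ (A * \1_B1 x) B2). Qed.

Lemma slice2_integrable y : m1.-integrable setT (fun x => (g (x, y))%:E).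
Proof.
apply: (@bounded_support_integrable _ _ _ _ _ (A * \1_B2 y) B1) => // x.
by rewrite mulrAC.
Qed.

Lemma prod_integrable : (m1 \x m2)%E.-integrable setT (EFin \o g).
Proof.
apply: (@bounded_support_integrable _ _ _ (m1 \x m2)%E _ A (B1 `*` B2)) => //.
- exact: measurableX.
- apply: (@le_lt_trans _ _ (m1 B1 * m2 B2)%E).
    by have := product_measure1E m1 m2 mB1 mB2 => /= ->.
  by rewrite lte_mul_pinfty// ge0_fin_numE.
- move=> [x y]; apply: le_trans (gA x y) _; rewrite -mulrA !indicE -natrM mulnb.
  rewrite (_ : _ && _ = ((x, y) \in B1 `*` B2))//.
  by apply/andP/idP => [[/set_mem ? /set_mem ?]|/set_mem[/= ? ?]];
    [|split]; exact/mem_set.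
Qed.

Lemma measurable_Rintegral1 :
  measurable_fun setT (fun x => \int[m2]_y g (x, y)).
Proof.
apply: measurableT_comp; first exact: fine_measurable.
exact: (measurable_fubini_F prod_integrable).
Qed.

Let fineE1 x : (\int[m2]_y g (x, y))%:E = (\int[m2]_y (g (x, y))%:E)%E.
Proof. by rewrite fineK//; apply: integrable_fin_num => //; exact: slice1_integrable. Qed.

Let fineE2 y : (\int[m1]_x g (x, y))%:E = (\int[m1]_x (g (x, y))%:E)%E.
Proof. by rewrite fineK//; apply: integrable_fin_num => //; exact: slice2_integrable. Qed.

Lemma Rintegral_prod :
  Rintegral (m1 \x m2)%E setT g = \int[m1]_x (\int[m2]_y g (x, y)).
Proof.
rewrite /Rintegral -(integral12_prod_meas1 prod_integrable); congr fine.
by apply: eq_integral => x _; rewrite -/(Rintegral _ _ _) fineE1.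
Qed.

Lemma Rintegral_swap :
  \int[m1]_x (\int[m2]_y g (x, y)) = \int[m2]_y (\int[m1]_x g (x, y)).
Proof.
rewrite -Rintegral_prod /Rintegral -(integral21_prod_meas1 prod_integrable).
congr fine.
by apply: eq_integral => x _; rewrite -/(Rintegral _ _ _) fineE2.
Qed.

(** The partial integral inherits the form of the bound on [g]; this keeps the class [bbs] below
    stable when coordinates are integrated out one at a time. *)
Lemma Rintegral1_bound x :
  `|\int[m2]_y g (x, y)| <= `|A| * fine (m2 B2) * \1_B1 x.
Proof.
apply: le_trans (le_normr_Rintegral measurableT (slice1_integrable x)) _.
have -> : `|A| * fine (m2 B2) * \1_B1 x = \int[m2]_y (`|A| * \1_B1 x * \1_B2 y).
  rewrite RintegralZl//.
    by rewrite /Rintegral integral_indic// setIT mulrAC.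
  apply: (@bounded_support_integrable _ _ _ _ _ 1 B2) => //.
  by move=> y; rewrite mul1r ger0_norm.
apply: le_Rintegral => //.
- by apply: integrable_norm; exact: slice1_integrable.
- apply: (@bounded_support_integrable _ _ _ _ _ (`|A| * \1_B1 x) B2) => //.
    by apply: measurable_funM => //; exact: measurable_indic.
  by move=> y; rewrite ger0_norm// mulr_ge0// mulr_ge0.
- move=> y _; apply: le_trans (gA x y) _.
  by rewrite -!mulrA ler_wpM2r ?mulr_ge0 ?ler_norm.
Qed.

Lemma Rintegral1_integrable :
  m1.-integrable setT (fun x => (\int[m2]_y g (x, y))%:E).
Proof.
apply: (@bounded_support_integrable _ _ _ _ _ (`|A| * fine (m2 B2)) B1) => //.
  exact: measurable_Rintegral1.
exact: Rintegral1_bound.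
Qed.

End fubini_bounded.

(** * Bounded functions supported in a box *)

Section bounded_box_support.
Context (R : realType).
Local Notation lbg := (@lebesgue_measure R).

(** Bounded with box support. All slices of such a function are integrable, so [Rintegral] never
    falls back on its default value 0, and integrating out a coordinate stays in the class. *)
Definition bbs n (f : 'rV[R]_n -> R) := measurable_fun setT f /\
  exists A K, forall x, `|f x| <= A * \1_(@box R n K) x.

Lemma bbs_integrable n (f : 'rV[R]_n -> R) : bbs f ->
  (lebesgue_rV R n).-integrable setT (EFin \o f).
Proof.
move=> [mf [A [K fA]]].
by apply: (@bounded_support_integrable _ _ _ _ _ A (@box R n K)) => //;
  [exact: measurable_box|exact: lebesgue_rV_box_lty].
Qed.

Lemma itv_lty (K : R) : (lbg `[(- K)%R, K]%classic < +oo)%E.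
Proof. by rewrite lebesgue_measure_itv/=; case: ifP => // _; rewrite ltry. Qed.

Lemma box_rcons n K (x : 'rV[R]_n) (r : R) :
  \1_(@box R n.+1 K) (rV_rcons (x, r)) = \1_(@box R n K) x * \1_(`[- K, K]%classic) r :> R.
Proof.
rewrite !indicE -natrM mulnb; congr (nat_of_bool _)%:R.
apply/idP/andP => [/set_mem h|[/set_mem h1 /set_mem h2]].
  split; apply/mem_set; last by have := h ord_max; rewrite mxE unlift_none.
  by move=> i; have := h (lift ord_max i); rewrite mxE liftK.
by apply/mem_set => i; rewrite mxE; case: unliftP => [j _|_]; [exact: h1|exact: h2].
Qed.

Lemma bbs_rcons n (f : 'rV[R]_n.+1 -> R) : bbs f ->
  bbs (fun x => \int[lbg]_r f (rV_rcons (x, r))) /\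
  \int[lebesgue_rV R n.+1]_x f x =
  \int[lebesgue_rV R n]_x \int[lbg]_r f (rV_rcons (x, r)).
Proof.
move=> [mf [A [K fA]]].
pose g (p : 'rV[R]_n * measurableTypeR R) := f (rV_rcons p).
have mg : measurable_fun setT g.
  by apply: measurableT_comp => //; exact: measurable_rV_rcons.
have gA x y : `|g (x, y)| <= A * \1_(@box R n K) x * \1_(`[- K, K]%classic) y.
  by rewrite -mulrA -box_rcons; exact: fA.
have mb := @measurable_box R n K.
have boo : (@leb R n (@box R n K) < +oo)%E := lebesgue_rV_box_lty n K.
have mi : measurable (`[- K, K]%classic : set (measurableTypeR R)).
  by [].
split.
  split; first exact: (measurable_Rintegral1 mg mb mi boo (itv_lty K) gA).
  exists (`|A| * fine (lbg `[- K, K]%classic)), K => x.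
  exact: (Rintegral1_bound mg mi (itv_lty K) gA x).
have gi := prod_integrable mg mb mi boo (itv_lty K) gA.
have := Rintegral_prod mg mb mi boo (itv_lty K) gA.
rewrite /Rintegral => <-; congr fine.
(* [lebesgue_rV] in dimension n + 1 is by construction the image of the product measure under
   [rV_rcons]. *)
rewrite -(@integral_pushforward _ _ _ _ R (@rV_rcons R n)
   (@measurable_rV_rcons R n) (@leb R n \x lbg)%E setT (EFin \o f)) //.
exact/measurable_EFinP.
Qed.

End bounded_box_support.

(** * Entropy and coordinate lines *)

Section lines.
Context (R : realType).
Local Notation lbg := (@lebesgue_measure R).

Definition upd n (i : 'I_n) (x : 'rV[R]_n) (r : R) : 'rV[R]_n :=
  \row_j (if j == i then r else x ord0 j).

Definition line n (f : 'rV[R]_n -> R) i x := \int[lbg]_s f (upd i x s).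

Definition marg n (f : 'rV[R]_n.+1 -> R) (x : 'rV[R]_n) :=
  \int[lbg]_r f (rV_rcons (x, r)).

Lemma upd_lift n (i : 'I_n) (x : 'rV[R]_n) r s :
  upd (lift ord_max i) (rV_rcons (x, r)) s = rV_rcons (upd i x s, r).
Proof.
apply/rowP => j; rewrite !mxE; case: unliftP => [k ->|->].
  by rewrite (inj_eq lift_inj) mxE.
by rewrite (negbTE (neq_lift _ _)).
Qed.

Lemma upd_max n (x : 'rV[R]_n) r s :
  upd ord_max (rV_rcons (x, r)) s = rV_rcons (x, s).
Proof.
apply/rowP => j; rewrite !mxE; case: unliftP => [k ->|->].
  by rewrite eq_sym (negbTE (neq_lift _ _)).
by rewrite eqxx.
Qed.

Lemma measurable_upd d (T : measurableType d) n (i : 'I_n) (x : 'rV[R]_n)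
  (f : T -> R) : measurable_fun setT f ->
  measurable_fun setT (fun t => upd i x (f t)).
Proof.
move=> mf; apply: measurable_fun_rV => j; rewrite (_ : (fun _ => _) =
    if j == i then f else cst (x ord0 j)); first by case: eqP.
by apply/funext => t; rewrite mxE; case: eqP.
Qed.

Lemma box_upd n K i (x : 'rV[R]_n) (r : R) :
  \1_(@box R n K) (upd i x r) <= \1_(`[- K, K]%classic) r :> R.
Proof.
rewrite !indicE ler_nat; case: (asboolP (box K (upd i x r))).
  by move=> h; rewrite !mem_set//; have := h i; rewrite mxE eqxx.
by move=> h; rewrite memNset.
Qed.

Lemma bbs_slice n (f : 'rV[R]_n -> R) i x : bbs f ->
  lbg.-integrable setT (fun s => (f (upd i x s))%:E).
Proof.
move=> [mf [A [K fA]]].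
apply: (@bounded_support_integrable _ _ _ lbg (fun s => f (upd i x s)) `|A|
    `[- K, K]%classic).
- by apply: measurableT_comp => //; exact: measurable_upd.
- exact: measurable_itv.
- exact: itv_lty.
- move=> s; apply: le_trans (fA _) _.
  rewrite (le_trans (ler_wpM2r _ (ler_norm _)))//.
  by apply: ler_wpM2l => //; exact: box_upd.
Qed.

Section double_slice.
Context n (f : 'rV[R]_n.+1 -> R) (i : 'I_n) (x : 'rV[R]_n) (bf : bbs f).

Let g (p : measurableTypeR R * measurableTypeR R) :=
  f (rV_rcons (upd i x p.1, p.2)).

Let hyps : exists A K, [/\ measurable_fun setT g,
  measurable (`[- K, K]%classic : set (measurableTypeR R)) &
  forall r s, `|g (r, s)| <= A * \1_`[- K, K]%classic r * \1_`[- K, K]%classic s].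
Proof.
case: bf => mf [A [K fA]]; exists `|A|, K; split.
- apply: measurableT_comp => //; apply: measurableT_comp.
    exact: measurable_rV_rcons.
  by apply: measurable_fun_pair => //; exact: measurable_upd.
- exact: measurable_itv.
- move=> r s; apply: le_trans (fA _) _; rewrite box_rcons mulrA.
  rewrite ler_wpM2r// (le_trans (ler_wpM2r _ (ler_norm _)))//.
  by apply: ler_wpM2l => //; exact: box_upd.
Qed.

(** Fubini in the plane of the i-th and the last coordinate. It carries line integrals through the
    removal of the last coordinate in inductions on the dimension. *)
Lemma line_marg : line (marg f) i x =
  \int[lbg]_r line f (lift ord_max i) (rV_rcons (x, r)).
Proof.
have [A [K [mg mi gA]]] := hyps.
rewrite /line /marg (Rintegral_swap mg mi mi (itv_lty K) (itv_lty K) gA).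
by apply: eq_Rintegral => r _; apply: eq_Rintegral => s _; rewrite upd_lift.
Qed.

Lemma line_rcons_integrable : lbg.-integrable setT
  (fun r => (line f (lift ord_max i) (rV_rcons (x, r)))%:E).
Proof.
have [A [K [mg mi gA]]] := hyps.
(* [Rintegral1_integrable] integrates out the second variable, while here the i-th coordinate, the
   first one of [g], has to go: hence the swap. *)
pose h (p : measurableTypeR R * measurableTypeR R) := g (p.2, p.1).
have mh : measurable_fun setT h.
  by apply: (measurableT_comp mg); exact: measurable_swap.
have hA r s : `|h (r, s)| <= A * \1_`[- K, K]%classic r * \1_`[- K, K]%classic s.
  by rewrite mulrAC; exact: gA.
have := Rintegral1_integrable mh mi mi (itv_lty K) (itv_lty K) hA.
apply: eq_integrable => // r _; congr EFin.
by apply: eq_Rintegral => s _; rewrite upd_lift.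
Qed.

End double_slice.

Lemma bbs_marg n (f : 'rV[R]_n.+1 -> R) : bbs f -> bbs (marg f).
Proof. by move=> /bbs_rcons[]. Qed.

Lemma Rintegral_marg n (f : 'rV[R]_n.+1 -> R) : bbs f ->
  Rintegral (lebesgue_rV R n.+1) setT f =
  Rintegral (lebesgue_rV R n) setT (marg f).
Proof. by move=> /bbs_rcons[]. Qed.

Lemma rcons_integrable n (f : 'rV[R]_n.+1 -> R) x : bbs f ->
  lbg.-integrable setT (fun r => (f (rV_rcons (x, r)))%:E).
Proof.
move=> bf; apply: eq_integrable (bbs_slice ord_max (rV_rcons (x, 0)) bf) => //.
by move=> r _; rewrite upd_max.
Qed.

Lemma line_max n (f : 'rV[R]_n.+1 -> R) x r :
  line f ord_max (rV_rcons (x, r)) = marg f x.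
Proof. by apply: eq_Rintegral => s _; rewrite upd_max. Qed.

(** Only the last coordinate can be peeled off. If [i] is another direction, it survives in
    [marg G], whose lines still integrate to 0 by [line_marg]; if [i] is the last one, [marg G]
    itself is 0. *)
Lemma Rintegral_line_eq0 n (G : 'rV[R]_n -> R) i : bbs G ->
  (forall x, line G i x = 0) -> Rintegral (lebesgue_rV R n) setT G = 0.
Proof.
elim: n G i => [? []//|n IH] G i bG G0; rewrite Rintegral_marg//.
case: (unliftP ord_max i) => [j ij|im].
  apply: (IH _ j); first exact: bbs_marg.
  move=> x; rewrite line_marg// (@eq_Rintegral _ _ _ _ _ (fun=> 0)).
    by rewrite /Rintegral integral0.
  by move=> r _; rewrite -ij.
rewrite (@eq_Rintegral _ _ _ _ _ (fun=> 0)); first by rewrite /Rintegral integral0.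
by move=> x _; rewrite /= -[LHS](line_max _ _ 0) -im.
Qed.

End lines.

(** * Lebesgue entropy bounded by line integrals *)

Section entropy.
Context (R : realType).
Local Notation lbg := (@lebesgue_measure R).
Local Notation II n f := (Rintegral (lebesgue_rV R n) setT f).

(** From ln y <= y at y = 1/a. This lower bound later makes Fatou's lemma applicable to a ln a +
    1. *)
Lemma xlnx_ge (a : R) : 0 <= a -> -1 <= a * ln a.
Proof.
rewrite le_eqVlt => /predU1P[<-|a0]; first by rewrite mul0r; lra.
have := @ln_sublinear R a^-1; rewrite invr_gt0 lnV// => /(_ a0) h.
have : a * (- ln a) <= a * a^-1 by rewrite ler_pM2l// ltW.
by rewrite divff ?gt_eqF//; nra.
Qed.

Lemma xlnx_le (a : R) : 0 <= a -> a * ln a <= a ^+ 2.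
Proof.
rewrite le_eqVlt => /predU1P[<-|a0]; first by rewrite mul0r expr0n.
by rewrite expr2 ler_pM2l// ltW// ln_sublinear.
Qed.

Lemma bbs_xlnx n (u : 'rV[R]_n -> R) : bbs u -> (forall x, 0 <= u x) ->
  bbs (fun x => u x * ln (u x)).
Proof.
move=> [mu [A [K uA]]] u0; split.
  by apply: measurable_funM => //; apply: measurableT_comp => //;
    exact: measurable_ln.
(* On the box u ln u lies between -1 and u^2 <= A^2; outside it u = 0 and the convention for [ln]
   gives 0. *)
exists (1 + A ^+ 2), K => x; have := uA x; rewrite indicE.
case: (x \in box K) => /=; rewrite ?mulr1 ?mulr0 => h; last first.
  by move: h; rewrite normr_le0 => /eqP ->; rewrite mul0r normr0.
rewrite ler_norml; apply/andP; split.
  by apply: le_trans (xlnx_ge (u0 x)); rewrite lerN2 lerDl sqr_ge0.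
apply: le_trans (xlnx_le (u0 x)) _; apply: ler_wpDl => //.
by have := u0 x; have := le_trans (ler_norm _) h; rewrite !expr2; nra.
Qed.

(* Trades [ln] of the supremum [M] of a slice of mass [v] for a linear term.  *)
Lemma ln_sup_le (delta v M : R) : 0 < delta -> 0 <= v -> 0 <= M ->
  (0 < v -> 0 < M) -> v * ln M <= v * ln v + delta * M - ln delta * v.
Proof.
move=> d0; rewrite le_eqVlt => /predU1P[<- M0 _|v0 _ /(_ v0) M0].
  by rewrite !mul0r mulr0 subr0 add0r mulr_ge0// ltW.
have h : ln (delta * M / v) < delta * M / v.
  by rewrite ln_sublinear// divr_gt0 ?mulr_gt0.
rewrite ln_div ?posrE ?mulr_gt0// in h; rewrite lnM ?posrE// in h.
have : v * (ln delta + ln M - ln v) <= v * (delta * M / v) by rewrite ler_pM2l// ltW.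
rewrite [X in _ <= X]mulrC divfK ?gt_eqF//; nra.
Qed.

(* Peel off the last coordinate: [M = marg (W ord_max) x] bounds the slice of  *)
(* [u] through [x], and both [u] and the other [W i] are replaced by their    *)
(* marginals.                                                                 *)
Lemma le_line_entropy n (u : 'rV[R]_n -> R) (W : 'I_n -> 'rV[R]_n -> R)
    (delta : R) : 0 < delta -> bbs u -> (forall x, 0 <= u x) ->
  (forall i, bbs (W i)) -> (forall i x, 0 <= W i x) ->
  (forall i x, u x <= line (W i) i x) ->
  II n (fun x => u x * ln (u x)) <=
  II n u * ln (II n u) + \sum_i (delta * II n (W i) - ln delta * II n u).
Proof.
move=> d0; elim: n u W => [|n IH] u W bu u0 bW W0 uW.
  rewrite big_ord0 addr0 /Rintegral /= !integral_dirac//=.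
  + by rewrite !indicE !mem_set// !mul1r.
  + by apply/measurable_EFinP; case: bu.
  + by apply/measurable_EFinP; case: (bbs_xlnx bu u0).
pose v := marg u; pose L := W ord_max.
have bv : bbs v by exact: bbs_marg.
have v0 x : 0 <= v x by exact: Rintegral_ge0.
have bW' i : bbs (marg (W (lift ord_max i))) by exact: bbs_marg.
have := IH v (fun i => marg (W (lift ord_max i))) bv v0 bW'.
have W'0 i x : 0 <= marg (W (lift ord_max i)) x by exact: Rintegral_ge0.
have vW' i x : v x <= line (marg (W (lift ord_max i))) i x.
  rewrite line_marg//; apply: le_Rintegral => //.
  - exact: rcons_integrable.
  - exact: line_rcons_integrable.
move=> /(_ W'0 vW'); rewrite -/v => {}IH.
have -> : II n.+1 u = II n v by rewrite Rintegral_marg.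
rewrite big_ord_recr/=.
have -> : \sum_(i < n) (delta * II n.+1 (W (widen_ord (leqnSn n) i)) - ln delta * II n v) =
    \sum_(i < n) (delta * II n (marg (W (lift ord_max i))) - ln delta * II n v).
  apply: eq_bigr => i _; rewrite -Rintegral_marg//; congr (_ * II _ (W _) - _).
  by apply/val_inj; rewrite /= /bump leqNgt ltn_ord.
rewrite addrA; apply: le_trans (lerD IH (lexx _)).
rewrite (Rintegral_marg (bbs_xlnx bu u0)) (Rintegral_marg (bW ord_max)) -/L.
have ivl := bbs_integrable (bbs_xlnx bv v0).
have iv := bbs_integrable bv.
have iL := bbs_integrable (bbs_marg (bW ord_max)).
have idL : (lebesgue_rV R n).-integrable setT (EFin \o (fun x => delta * marg L x)).
  by under [EFin \o _]eq_fun do rewrite /= EFinM; exact: integrableZl.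
have idv : (lebesgue_rV R n).-integrable setT (EFin \o (fun x => ln delta * v x)).
  by under [EFin \o _]eq_fun do rewrite /= EFinM; exact: integrableZl.
have isum : (lebesgue_rV R n).-integrable setT
    (EFin \o (fun x => delta * marg L x - ln delta * v x)).
  by under [EFin \o _]eq_fun do rewrite /= EFinB; exact: integrableB.
rewrite -!RintegralZl// -RintegralB// -RintegralD//.
apply: le_Rintegral => //.
- exact: (bbs_integrable (bbs_marg (bbs_xlnx bu u0))).
- exact: (integrableD measurableT ivl isum).
move=> x _; rewrite addrA.
have M0 : 0 <= marg L x by apply: Rintegral_ge0 => r _; exact: W0.
have uM r : u (rV_rcons (x, r)) <= marg L x.
  by rewrite -(line_max L x r); exact: uW.
have irc := rcons_integrable x bu.
apply: le_trans (ln_sup_le d0 (v0 x) M0 _).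
  rewrite /v /marg -RintegralZr//; apply: le_Rintegral => //.
  - exact: (rcons_integrable x (bbs_xlnx bu u0)).
  - by under [EFin \o _]eq_fun do rewrite /= EFinM; exact: integrableZr.
  - move=> r _; have := u0 (rV_rcons (x, r)).
    rewrite le_eqVlt => /predU1P[<-|ur]; first by rewrite !mul0r.
    by rewrite ler_pM2l// ler_ln// posrE (lt_le_trans ur).
(* If the bound M of the slice were 0, the slice would vanish identically and its mass [v x] could
   not be positive. *)
move=> vx; rewrite lt_neqAle M0 andbT; apply/eqP => M00.
have : v x <= \int[lbg]_r (cst 0 r).
  apply: le_Rintegral => //; first exact: integrable0.
  by move=> r _; rewrite /= M00.
by rewrite /Rintegral integral0 leNgt vx.
Qed.

End entropy.

(** * Partial derivatives along lines *)

Section real_line.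
Context (R : realType).
Local Notation lbg := (@lebesgue_measure R).
Variables (h h' : R -> R) (K : R).
Hypotheses (dh : forall r, is_derive r (1:R) h (h' r)) (ch' : continuous h')
  (h0 : forall r, K <= `|r| -> h r = 0) (h'0 : forall r, K <= `|r| -> h' r = 0)
  (ih' : lbg.-integrable setT (EFin \o h')).

Lemma integral_derive (a b : R) : a < b ->
  (\int[lbg]_(x in `[a, b]) (h' x)%:E = (h b)%:E - (h a)%:E)%E.
Proof.
have dh1 r : derivable h r 1 by have [] := dh r.
have ch : continuous h.
  by move=> r; apply: differentiable_continuous; exact/derivable1_diffP.
move=> ab; apply: continuous_FTC2 => //.
- exact: continuous_subspaceT.
- by split=> //; [exact/cvg_at_right_filter/ch|exact/cvg_at_left_filter/ch].
- by move=> x _; rewrite derive1E derive_val.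
Qed.

Lemma Rintegral_derive_eq0 : 0 < K -> \int[lbg]_r h' r = 0.
Proof.
move=> K0; rewrite /Rintegral (_ : integral _ _ _ =
    (\int[lbg]_(x in `[(- K)%R, K]) (h' x)%:E)%E).
  have hK : h K = 0 by rewrite h0// ger0_norm// ltW.
  have hNK : h (- K) = 0 by rewrite h0// normrN ger0_norm// ltW.
  by rewrite integral_derive ?gtrN// hK hNK sube0.
rewrite [RHS]integral_mkcond; apply: eq_integral => r _.
rewrite patchE; case: ifPn => // /negP; rewrite inE/= in_itv/= => /negP rK.
by rewrite h'0// leNgt ltr_norml; apply: contra rK => /andP[/ltW-> /ltW->].
Qed.

(** Since [h] vanishes at -K, [h r] is the integral of [h'] over [-K, r]. *)
Lemma le_Rintegral_derive r : `|h r| <= \int[lbg]_s `|h' s|.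
Proof.
have [rK|rK] := leP K `|r|; first by rewrite h0// normr0; exact: Rintegral_ge0.
have ih'n := integrable_norm ih'.
have Kr : - K < r by move: rK; rewrite ltr_norml => /andP[].
rewrite -lee_fin fineK; last exact: integrable_fin_num.
have K0 : 0 < K by rewrite (le_lt_trans _ rK).
have -> : (`|h r|%:E = `| \int[lbg]_(x in `[(- K)%R, r]) (h' x)%:E |)%E.
  have hNK : h (- K) = 0 by rewrite h0// normrN ger0_norm// ltW.
  by rewrite integral_derive// hNK sube0.
have mh' : measurable_fun setT (EFin \o h') by case/integrableP: ih'.
apply: le_trans (le_abse_integral _ _ _) _ => //.
  exact: measurable_funS mh'.
apply: ge0_subset_integral => //.
by apply/measurable_EFinP; apply: measurableT_comp => //; exact/measurable_EFinP.
Qed.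

End real_line.

Section partial_derivatives.
Context (R : realType) (n : nat).
Local Notation lbg := (@lebesgue_measure R).
Implicit Types (f g : 'rV[R]_n -> R) (i : 'I_n) (x : 'rV[R]_n).

(** Stated along the lines s |-> [upd i x s], so that the fundamental theorem of calculus and the
    product and chain rules are used in one variable. *)
Definition is_partial i f f' := forall x r,
  is_derive r (1:R) (fun s => f (upd i x s)) (f' (upd i x r)).

Lemma updE i x r : upd i x r = x + (r - x ord0 i) *: delta_mx ord0 i.
Proof.
apply/rowP => j; rewrite !mxE eqxx/=; case: eqP => [->|_]/=.
  by rewrite mulr1 addrC subrK.
by rewrite mulr0 addr0.
Qed.

Lemma upd_id i x : upd i x (x ord0 i) = x.
Proof. by rewrite updE subrr scale0r addr0. Qed.

Lemma continuous_upd i x : continuous (upd i x).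
Proof.
rewrite (_ : upd i x = fun r => x + (r - x ord0 i) *: delta_mx ord0 i).
  move=> r; apply: cvgD; first exact: cvg_cst.
  by apply: cvgZr_tmp; apply: cvgB; [exact: cvg_id|exact: cvg_cst].
by apply/funext => r; exact: updE.
Qed.

Lemma differentiable_is_partial i f : (forall x, differentiable f x) ->
  is_partial i f (partial i f).
Proof.
move=> df x r; set y := upd i x r.
(* Moving the i-th coordinate from r to r + h adds h times the i-th basis vector, so both difference
   quotients coincide before any limit is taken. *)
have E : (fun h : R => h^-1 *: (((fun s => f (upd i x s)) \o shift r) (h *: (1:R))
      - f (upd i x r))) =
    (fun h : R => h^-1 *: ((f \o shift y) (h *: delta_mx ord0 i) - f y)).
  apply/funext => h /=; congr (_ *: (f _ - _)).
  rewrite /y !updE [h *: 1]mulr1 addrCA; congr (_ + _).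
  by rewrite -scalerDl addrA.
have dy : derivable f y (delta_mx ord0 i) by exact: diff_derivable.
by split; [rewrite /derivable E|rewrite /derive E].
Qed.

Lemma is_partial_eq i f g f' g' : is_partial i f f' -> f =1 g -> f' =1 g' ->
  is_partial i g g'.
Proof. by move=> + /funext <- /funext <-. Qed.

Lemma is_partial_cst i (c : R) : is_partial i (fun=> c) (fun=> 0).
Proof. by move=> x r; exact: is_derive_cst. Qed.

Lemma is_partial_coord i j :
  is_partial i (fun x => x ord0 j) (fun=> (j == i)%:R).
Proof.
move=> x r; have [->|ji] := eqVneq j i.
  rewrite (_ : (fun s => _) = id); first exact: is_derive_id.
  by apply/funext => s; rewrite mxE eqxx.
rewrite (_ : (fun s => _) = cst (x ord0 j)); first exact: is_derive_cst.
by apply/funext => s; rewrite mxE (negbTE ji).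
Qed.

Lemma is_partialD i f f' g g' : is_partial i f f' -> is_partial i g g' ->
  is_partial i (fun x => f x + g x) (fun x => f' x + g' x).
Proof.
move=> pf pg x r; have pf1 := pf x r; have pg1 := pg x r.
exact: (is_deriveD pf1 pg1).
Qed.

Lemma is_partialM i f f' g g' : is_partial i f f' -> is_partial i g g' ->
  is_partial i (fun x => f x * g x) (fun x => f' x * g x + f x * g' x).
Proof.
move=> pf pg x r; have pf1 := pf x r; have pg1 := pg x r.
apply: (is_derive_eq (is_deriveM pf1 pg1)).
by rewrite addrC [in LHS]/GRing.scale/= mulrC.
Qed.

Lemma is_partial_comp i f f' (g g' : R -> R) : is_partial i f f' ->
  (forall r, is_derive r (1:R) g (g' r)) ->
  is_partial i (fun x => g (f x)) (fun x => g' (f x) * f' x).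
Proof.
move=> pf dg x r; have pf1 := pf x r; have dg1 := dg (f (upd i x r)).
exact: (is_derive1_comp dg1 pf1).
Qed.

Lemma continuous_bbs f (K : R) : continuous f ->
  (forall x, ~ box K x -> f x = 0) -> bbs f.
Proof.
move=> cf f0; split; first exact: continuous_measurable_rV.
have cbox : compact (@box R n K).
  by apply: (@rV_compact _ _ (fun=> `[- K, K]%classic)) => _; exact: segment_compact.
have /compact_bounded[M [_ MP]] : compact (f @` box K).
  by apply: continuous_compact => //; exact: continuous_subspaceT.
(* [compact_bounded] makes every number strictly above [M] a bound, hence M + 1. *)
exists (M + 1), K => x; rewrite indicE; case: (asboolP (box K x)) => xK.
  by rewrite mem_set// mulr1; apply: MP; [rewrite ltrDl|exists x].
by rewrite memNset// mulr0 f0// normr0.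
Qed.

Section compact_support.
Variables (i : 'I_n) (f f' : 'rV[R]_n -> R) (K : R).
Hypotheses (K0 : 0 < K) (pf : is_partial i f f') (cf' : continuous f')
  (f0 : forall x, K <= `|x ord0 i| -> f x = 0)
  (f'0 : forall x, K <= `|x ord0 i| -> f' x = 0) (bf' : bbs f').

Let cf'u x : continuous (fun s => f' (upd i x s)).
Proof. by move=> s; apply: continuous_comp; [exact: continuous_upd|exact: cf']. Qed.

Lemma line_partial_eq0 x : line f' i x = 0.
Proof.
apply: (@Rintegral_derive_eq0 R _ _ K (pf x)) => //.
- by move=> r Kr; rewrite f0// mxE eqxx.
- by move=> r Kr; rewrite f'0// mxE eqxx.
Qed.

Lemma le_line_partial x : `|f x| <= line (fun x => `|f' x|) i x.
Proof.
rewrite -{1}(upd_id i x).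
apply: (@le_Rintegral_derive R (fun s => f (upd i x s)) _ K (pf x)) => //.
- by move=> r Kr; rewrite f0// mxE eqxx.
- exact: bbs_slice.
Qed.

End compact_support.

End partial_derivatives.

(** * Densities and cutoffs *)

Section density.
Context d (T : measurableType d) (R : realType).
Variables (m nu : {measure set T -> \bar R}) (rho : T -> R).
Hypotheses (mrho : measurable_fun setT rho) (rho0 : forall x, 0 <= rho x)
  (nuE : forall A, measurable A -> nu A = (\int[m]_(x in A) (rho x)%:E)%E).
Local Open Scope ereal_scope.

Import HBNNSimple.

Let integral_density_indic A : measurable A ->
  \int[nu]_x (\1_A x)%:E = \int[m]_x ((\1_A x)%:E * (rho x)%:E).
Proof.
move=> mA; rewrite integral_indic// setIT nuE// integral_mkcond.
apply: eq_integral => x _; rewrite patchE indicE.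
by case: ifPn => _; rewrite ?mul1e ?mul0e.
Qed.

Let integral_density_nnsfun (h : {nnsfun T >-> R}) :
  \int[nu]_x (h x)%:E = \int[m]_x ((h x)%:E * (rho x)%:E).
Proof.
under [LHS]eq_integral do rewrite fimfunE -fsumEFin//.
rewrite [LHS]ge0_integral_fsum//; last 2 first.
  - by move=> r; exact/measurable_EFinP/measurableT_comp.
  - by move=> n x _; rewrite EFinM nnfun_muleindic_ge0.
under [RHS]eq_integral.
  move=> x xD; rewrite fimfunE -fsumEFin// ge0_mule_fsuml; last first.
    by move=> r; rewrite EFinM nnfun_muleindic_ge0.
  over.
rewrite [RHS]ge0_integral_fsum//; last 2 first.
  - move=> r; apply: emeasurable_funM; last exact/measurable_EFinP.
    by apply/measurable_EFinP/measurableT_comp.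
  - move=> r x _; rewrite mule_ge0 ?lee_fin//.
    by rewrite -lee_fin EFinM nnfun_muleindic_ge0.
apply: eq_fsbigr => r rh; have r0 : (0 <= r)%R.
  by have [x _ <-] := set_mem rh.
under eq_integral do rewrite EFinM.
rewrite ge0_integralZl//.
- rewrite integral_density_indic// -ge0_integralZl//.
  + by apply: eq_integral => x _; rewrite EFinM muleA.
  + apply: emeasurable_funM; last exact/measurable_EFinP.
    exact/measurable_EFinP/measurable_indic.
  + by move=> x _; rewrite mule_ge0 ?lee_fin.
- exact/measurable_EFinP/measurable_indic.
Qed.

(** From indicators to simple functions by linearity, then to nonnegative functions by monotone
    convergence on both sides. *)
Lemma ge0_integral_density (f : T -> \bar R) :
  measurable_fun setT f -> (forall x, 0 <= f x) ->
  \int[nu]_x f x = \int[m]_x (f x * (rho x)%:E).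
Proof.
move=> mf f0; pose h := nnsfun_approx measurableT mf.
transitivity (lim (\int[nu]_x (h n x)%:E @[n --> \oo])).
  rewrite -monotone_convergence//=.
  - by apply: eq_integral => x _; apply/esym/cvg_lim => //; exact: cvg_nnsfun_approx.
  - by move=> n; exact/measurable_EFinP/measurable_funTS.
  - by move=> n x _; rewrite lee_fin.
  - by move=> x _ a b ab; rewrite lee_fin; exact/lefP/nd_nnsfun_approx.
under eq_fun do rewrite integral_density_nnsfun.
rewrite -monotone_convergence//=.
- apply: eq_integral => x _; apply/cvg_lim => //.
  by apply: cvgeZr => //; exact: cvg_nnsfun_approx.
- move=> n; apply: emeasurable_funM; last exact/measurable_EFinP.
  exact/measurable_EFinP/measurable_funTS.
- by move=> n x _; rewrite mule_ge0 ?lee_fin.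
- move=> x _ a b ab; rewrite lee_wpmul2r ?lee_fin//.
  exact/lefP/nd_nnsfun_approx.
Qed.

(** Multiplication by [rho] >= 0 commutes with positive and negative parts, so the two integrals
    already agree in the extended reals. *)
Lemma Rintegral_density (f : T -> R) : measurable_fun setT f ->
  Rintegral nu setT f = Rintegral m setT (fun x => f x * rho x)%R.
Proof.
move=> mf; have mEf : measurable_fun setT (EFin \o f) by exact/measurable_EFinP.
congr fine; rewrite [LHS]integralE [RHS]integralE.
rewrite (ge0_integral_density (measurable_funepos mEf))//.
rewrite (ge0_integral_density (measurable_funeneg mEf))//.
congr (_ - _); apply: eq_integral => x _.
  by rewrite !funeposE -!EFin_max/= -EFinM maxr_pMl// mul0r.
by rewrite !funenegE -!EFinN -!EFin_max/= -EFinM maxr_pMl// mul0r mulNr.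
Qed.

End density.

Section continuity.
Context (R : realType).

Lemma continuous_cst (T : topologicalType) (c : R) : continuous (fun _ : T => c).
Proof. by move=> x; exact: cvg_cst. Qed.

Lemma continuous_add (T : topologicalType) (f g : T -> R) :
  continuous f -> continuous g -> continuous (fun x => f x + g x).
Proof. by move=> cf cg x; apply: cvgD; [exact: cf|exact: cg]. Qed.

Lemma continuous_mul (T : topologicalType) (f g : T -> R) :
  continuous f -> continuous g -> continuous (fun x => f x * g x).
Proof. by move=> cf cg x; apply: cvgM; [exact: cf|exact: cg]. Qed.

Lemma continuous_opp (T : topologicalType) (f : T -> R) :
  continuous f -> continuous (fun x => - f x).
Proof. by move=> cf x; apply: cvgN; exact: cf. Qed.

Lemma continuous_normr (T : topologicalType) (f : T -> R) :
  continuous f -> continuous (fun x => `|f x|).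
Proof. by move=> cf x; apply: cvg_norm; exact: cf. Qed.

Lemma continuous_sum (T : topologicalType) (I : finType) (f : I -> T -> R) :
  (forall i, continuous (f i)) -> continuous (fun x => \sum_i f i x).
Proof.
move=> cf; elim: (index_enum I) => [|i s IH].
  rewrite [X in continuous X](_ : _ = cst 0); first by move=> x; exact: cvg_cst.
  by apply/funext => x; rewrite big_nil.
rewrite [X in continuous X](_ : _ = fun x => f i x + \sum_(j <- s) f j x).
  by move=> x; apply: cvgD; [exact: cf|exact: IH].
by apply/funext => x; rewrite big_cons.
Qed.

Lemma cvg_max0 (T : Type) (F : set_system T) (FF : Filter F) (f : T -> R) (a : R) :
  f @ F --> a -> Num.max 0 (f x) @[x --> F] --> Num.max 0 a.
Proof.
have E (r : R) : Num.max 0 r = (r + `|r|) * 2^-1.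
  by have [r0|r0] := ltP 0 r; [rewrite gtr0_norm//|rewrite ler0_norm//]; lra.
move=> fa; under eq_fun do rewrite E; rewrite E.
apply: cvgM; last exact: cvg_cst.
by apply: cvgD => //; exact: cvg_norm.
Qed.

Lemma continuous_max0 (T : topologicalType) (f : T -> R) :
  continuous f -> continuous (fun x => Num.max 0 (f x)).
Proof. by move=> cf x; apply: cvg_max0; exact: cf. Qed.

End continuity.

(** * Cutoff functions *)

Section cutoff.
Context (R : realType).

(** Squaring removes the kink of the positive part: the first-order remainder is at most h^2,
    whatever the signs of s and s + h. *)
Lemma is_derive_sqr_max (s : R) :
  is_derive s (1:R) (fun r => Num.max 0 r ^+ 2) (2 * Num.max 0 s).
Proof.
suff H : (fun h : R => h^-1 *: (((fun r => Num.max 0 r ^+ 2) \o shift s) (h *: (1:R))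
    - Num.max 0 s ^+ 2)) @ 0^' --> 2 * Num.max 0 s.
  by split; [apply/cvg_ex; exists (2 * Num.max 0 s)|exact: cvg_lim H].
apply/cvgrPdist_le => e e0.
near=> h; have h0 : h != 0 by near: h; exact: nbhs_dnbhs_neq.
have he : `|h| <= e.
  near: h; apply: dnbhs0_le => //.
rewrite /= [h *: 1]mulr1 -[X in X - _](mulKf h0) -[_ *: _]/(_ * _) -mulrBr.
rewrite normrM normfV ler_pdivrMl ?normr_gt0//.
apply: (@le_trans _ _ (`|h| * `|h|)); last by rewrite ler_wpM2l.
rewrite -normrM -expr2 [leRHS]ger0_norm ?sqr_ge0// ler_norml.
by rewrite !expr2; have [?|?] := leP 0 s; have [?|?] := leP 0 (h + s);
  apply/andP; split; nra.
Unshelve. all: by end_near. Qed.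

Context (n : nat).
Implicit Types (x : 'rV[R]_n) (i : 'I_n).

Definition radial (N : R) x := Num.max 0 (1 - dotp x x / N ^+ 2).

(** The square makes the cutoff C^1 and bounds its slope by a multiple of its square root, see
    [dcutoff_sqr_le]. *)
Definition cutoff N x := radial N x ^+ 2.

Definition dcutoff N i x := 2 * radial N x * (- (2 * x ord0 i / N ^+ 2)).

Lemma is_partial_dotp i : is_partial i (fun x => dotp x x) (fun x => 2 * x ord0 i).
Proof.
move=> x r; pose c := \sum_(j | j != i) x ord0 j ^+ 2.
have E s : dotp (upd i x s) (upd i x s) = s * s + c.
  rewrite /dotp (bigD1 i)//= !mxE eqxx; congr (_ + _).
  by apply: eq_bigr => j ji; rewrite !mxE (negbTE ji) expr2.
rewrite (_ : (fun s => _) = (id * id + cst c)%R); last first.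
  by apply/funext => s; rewrite E.
apply: is_derive_eq.
by rewrite mxE eqxx addr0 /GRing.scale/= mulr1 -mulr2n mulr_natl.
Qed.

Lemma continuous_coord i : continuous (fun x => x ord0 i).
Proof. exact: coord_continuous. Qed.

Lemma continuous_dotp : continuous (fun x => dotp x x).
Proof.
by apply: continuous_sum => i; apply: continuous_mul; exact: continuous_coord.
Qed.

Variables (N : R).
Hypothesis N1 : 1 <= N.

Let N0 : 0 < N ^+ 2. Proof. by rewrite exprn_gt0// (lt_le_trans _ N1). Qed.

Lemma continuous_radial : continuous (radial N).
Proof.
apply: continuous_max0; apply: continuous_add; first exact: continuous_cst.
apply: continuous_opp; apply: continuous_mul; last exact: continuous_cst.
exact: continuous_dotp.
Qed.

Lemma continuous_cutoff : continuous (cutoff N).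
Proof. by apply: continuous_mul; exact: continuous_radial. Qed.

Lemma continuous_dcutoff i : continuous (dcutoff N i).
Proof.
apply: continuous_mul.
  by apply: continuous_mul; [exact: continuous_cst|exact: continuous_radial].
apply: continuous_opp; apply: continuous_mul; last exact: continuous_cst.
by apply: continuous_mul; [exact: continuous_cst|exact: continuous_coord].
Qed.

Lemma is_partial_cutoff i : is_partial i (cutoff N) (dcutoff N i).
Proof.
have h : is_partial i (fun x => 1 - dotp x x / N ^+ 2)
    (fun x => - (2 * x ord0 i / N ^+ 2)).
  apply: (is_partial_eq (is_partialD (is_partial_cst i 1)
    (is_partialM (is_partial_dotp i) (is_partial_cst i (- (N ^+ 2)^-1))))) => x.
    by rewrite mulrN.
  by rewrite add0r mulr0 addr0 mulrN.
exact: (is_partial_comp h is_derive_sqr_max).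
Qed.

Lemma sqr_coord_le_dotp x i : x ord0 i ^+ 2 <= dotp x x.
Proof.
rewrite /dotp (bigD1 i)//= -expr2 lerDl sumr_ge0// => j _.
by rewrite -expr2 sqr_ge0.
Qed.

Lemma dotp_ge0 x : 0 <= dotp x x.
Proof. by apply: sumr_ge0 => j _; rewrite -expr2 sqr_ge0. Qed.

Lemma radial_ge0 x : 0 <= radial N x.
Proof. by rewrite le_max lexx. Qed.

Lemma radial_le1 x : radial N x <= 1.
Proof. by rewrite ge_max ler01 gerBl divr_ge0 ?dotp_ge0 ?ltW. Qed.

Lemma cutoff_ge0 x : 0 <= cutoff N x. Proof. exact: sqr_ge0. Qed.

Lemma cutoff_le1 x : cutoff N x <= 1.
Proof. by rewrite expr_le1// ?radial_ge0// radial_le1. Qed.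

Lemma radial_eq0 x i : N <= `|x ord0 i| -> radial N x = 0.
Proof.
move=> Nx; apply/max_idPl; rewrite subr_le0 ler_pdivlMr// mul1r.
apply: le_trans (sqr_coord_le_dotp x i).
rewrite -[leRHS]real_normK ?num_real// lerXn2r// ?nnegrE//.
by rewrite (le_trans _ N1).
Qed.

(** Where [radial] is nonzero, x lies in the ball of radius N; the factor [radial] disposes of the
    other points. *)
Lemma radial_mul_coord x i : radial N x * x ord0 i ^+ 2 <= radial N x * N ^+ 2.
Proof.
have [->|r0] := eqVneq (radial N x) 0; first by rewrite !mul0r.
apply: ler_wpM2l; first exact: radial_ge0.
apply: le_trans (sqr_coord_le_dotp x i) _; rewrite leNgt; apply: contra r0 => h.
apply/eqP/max_idPl; rewrite subr_le0 ler_pdivlMr// mul1r; exact: ltW.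
Qed.

(** The square of the slope is 16 radial^2 x_i^2 / N^4, with |x_i| <= N on the support and N >= 1.
    The constant does not depend on N. *)
Lemma dcutoff_sqr_le x i : dcutoff N i x ^+ 2 <= 16 * cutoff N x.
Proof.
have -> : dcutoff N i x ^+ 2 =
    16 * radial N x * ((radial N x * x ord0 i ^+ 2) / N ^+ 2) / N ^+ 2.
  by rewrite /dcutoff; field; apply: lt0r_neq0; rewrite (lt_le_trans _ N1).
have h : radial N x * x ord0 i ^+ 2 / N ^+ 2 <= radial N x.
  by rewrite ler_pdivrMr// radial_mul_coord.
rewrite ler_pdivrMr// /cutoff; move: h (radial_ge0 x) (exprn_ege1 2 N1).
move: (radial N x * _ / _) => X; move: (radial N x) (N ^+ 2) => r M Xr r0 M1.
by have := mulr_ge0 r0 r0; have := ler_wpM2l r0 Xr; nra.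
Qed.

(** Controls, uniformly in N, the cutoff error produced by the linearly growing field C1 x. *)
Lemma coord_dcutoff_le x i : `|x ord0 i * dcutoff N i x| <= 4.
Proof.
have -> : x ord0 i * dcutoff N i x = - (4 * (radial N x * x ord0 i ^+ 2 / N ^+ 2)).
  by rewrite /dcutoff; field; apply: lt0r_neq0; rewrite (lt_le_trans _ N1).
have X0 : 0 <= radial N x * x ord0 i ^+ 2 / N ^+ 2.
  apply: divr_ge0; last exact: ltW.
  by apply: mulr_ge0; [exact: radial_ge0|exact: sqr_ge0].
rewrite normrN ger0_norm; last exact: mulr_ge0.
rewrite -[leRHS]mulr1 ler_wpM2l// ler_pdivrMr// (le_trans (radial_mul_coord x i))//.
by rewrite ler_wpM2r ?radial_le1// ltW.
Qed.

End cutoff.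

Lemma cvg_cutoff (R : realType) n (x : 'rV[R]_n) :
  cutoff k.+1%:R x @[k --> \oo] --> (1 : R).
Proof.
have h : (1 - dotp x x * (k.+1%:R^-1 * k.+1%:R^-1)) @[k --> \oo] --> (1 - dotp x x * (0 * 0) : R).
  apply: cvgB; first exact: cvg_cst.
  by apply: cvgM; [exact: cvg_cst|apply: cvgM; exact: cvg_harmonic].
have {}h : radial k.+1%:R x @[k --> \oo] --> (1 : R).
  rewrite mul0r mulr0 subr0 in h.
  rewrite [X in _ --> X](_ : _ = Num.max 0 1); last by apply/esym/max_idPr.
  by apply: cvg_max0; under eq_fun do rewrite expr2 invfM.
by rewrite -[X in _ --> X](mulr1 1); apply: cvgM.
Qed.

(** * Entropy bound from a pointwise inequality *)

Lemma Rintegral_sum d (T : measurableType d) (R : realType)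
    (m : {measure set T -> \bar R}) (I : finType) (f : I -> T -> R) :
  (forall i, m.-integrable setT (EFin \o f i)) ->
  m.-integrable setT (EFin \o (fun x => \sum_i f i x)) /\
  Rintegral m setT (fun x => \sum_i f i x) = \sum_i Rintegral m setT (f i).
Proof.
move=> fi; elim: (index_enum I) => [|i s [IH1 IH2]].
  rewrite (_ : (fun x => _) = cst 0); last by apply/funext => x; rewrite big_nil.
  rewrite big_nil; split; first exact: integrable0.
  by rewrite /Rintegral integral0.
rewrite (_ : (fun x => _) = (fun x => f i x + \sum_(j <- s) f j x)); last first.
  by apply/funext => x; rewrite big_cons.
rewrite big_cons -IH2 RintegralD//; split=> //.
exact: (integrableD measurableT (fi i) IH1).
Qed.

Section core.
Context (R : realType) (d : nat) (V : 'rV[R]_d -> R) (mu : probability 'rV[R]_d R).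
Hypothesis mu_density : forall A : set 'rV[R]_d, measurable A ->
  mu A = (\int[lebesgue_rV R d]_(x in A) (expR (- V x))%:E)%E.
Variables (V_ : 'I_d -> 'rV[R]_d -> R) (F : 'rV[R]_d -> R)
  (F_ X_ Y_ : 'I_d -> 'rV[R]_d -> R).
Hypotheses (cV : continuous V) (cV_ : forall i, continuous (V_ i))
  (pV : forall i, is_partial i V (V_ i))
  (cF : continuous F) (cF_ : forall i, continuous (F_ i))
  (pF : forall i, is_partial i F (F_ i))
  (cX_ : forall i, continuous (X_ i)) (cY_ : forall i, continuous (Y_ i))
  (pX : forall i, is_partial i (X_ i) (Y_ i)).
Local Notation II f := (Rintegral (lebesgue_rV R d) setT f).
Let rho x := expR (- V x).

Let crho : continuous rho.
Proof.
move=> x; apply: (@continuous_comp _ _ _ (fun x => - V x) expR).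
  exact: continuous_opp.
exact: continuous_expR.
Qed.

Let prho i : is_partial i rho (fun x => rho x * (- V_ i x)).
Proof.
apply: (@is_partial_comp _ _ _ (fun x => - V x) (fun x => - V_ i x) expR expR).
  apply: (is_partial_eq (is_partialM (is_partial_cst i (-1)) (pV i))) => x.
    by rewrite mulN1r.
  by rewrite mul0r add0r mulN1r.
Qed.

Lemma bbs_mu_integrable (f : 'rV[R]_d -> R) : bbs f ->
  mu.-integrable setT (EFin \o f).
Proof.
move=> [mf [A [K fA]]].
apply: (@bounded_support_integrable _ _ _ mu _ A (box K)) => //.
  exact: measurable_box.
by rewrite ltey_eq fin_num_measure//; exact: measurable_box.
Qed.

Section truncated.
Variable N : R.
Hypothesis N1 : 1 <= N.

Let theta := @cutoff R d N.
Let w x := theta x * F x ^+ 2.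
Let w_ i x := dcutoff N i x * F x ^+ 2 + theta x * (2 * F x * F_ i x).

Let vanish x : ~ box N x -> theta x = 0 /\ forall i, dcutoff N i x = 0.
Proof.
move=> /existsNP[i]; rewrite /= in_itv/= => /negP; rewrite -ler_norml -ltNge.
move=> /ltW/(radial_eq0 N1) r0.
by split=> [|j]; rewrite /theta /cutoff /dcutoff r0 ?expr0n// mulr0 mul0r.
Qed.

Let vanishw x : ~ box N x -> w x = 0 /\ forall i, w_ i x = 0.
Proof.
move=> /vanish[t0 d0].
by split=> [|i]; rewrite /w /w_ t0 ?d0 !mul0r ?addr0.
Qed.

Let vanish_coord (i : 'I_d) (x : 'rV[R]_d) : N <= `|x ord0 i| -> theta x = 0 /\ dcutoff N i x = 0.
Proof.
move=> /(radial_eq0 N1) r0.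
by split; rewrite /theta /cutoff /dcutoff r0 ?expr0n// mulr0 mul0r.
Qed.

Let vanishw_coord (i : 'I_d) (x : 'rV[R]_d) : N <= `|x ord0 i| -> w x = 0 /\ w_ i x = 0.
Proof. by move=> /vanish_coord[t0 d0]; rewrite /w /w_ t0 d0 !mul0r addr0. Qed.

Let cF2 : continuous (fun x => F x ^+ 2).
Proof. exact: continuous_mul. Qed.

Let cw : continuous w.
Proof. by apply: continuous_mul => //; exact: continuous_cutoff. Qed.

Let cw_ i : continuous (w_ i).
Proof.
apply: continuous_add; apply: continuous_mul => //.
- exact: continuous_dcutoff.
- exact: continuous_cutoff.
- apply: continuous_mul => //; apply: continuous_mul => //; exact: continuous_cst.
Qed.

Let pw i : is_partial i w (w_ i).
Proof.
apply: (is_partial_eq (is_partialM (is_partial_cutoff N i)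
  (is_partialM (pF i) (pF i)))) => x //.
by rewrite /w_ expr2; congr (_ + _ * _); ring.
Qed.

Let u x := w x * rho x.
Let u_ i x := (w_ i x - w x * V_ i x) * rho x.
(** The i-th term of div (w X e^(-V)), with e^(-V) factored out; [u_ i] above is likewise d_i (w
    e^(-V)). *)
Let G_ i x := (w_ i x * X_ i x + w x * Y_ i x - w x * X_ i x * V_ i x) * rho x.

Let pu i : is_partial i u (u_ i).
Proof.
by apply: (is_partial_eq (is_partialM (pw i) (prho i))) => x //; rewrite /u_; ring.
Qed.

Let pG i : is_partial i (fun x => w x * X_ i x * rho x) (G_ i).
Proof.
apply: (is_partial_eq (is_partialM (is_partialM (pw i) (pX i)) (prho i))) => x //.
by rewrite /G_; ring.
Qed.

Let cu_ i : continuous (u_ i).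
Proof.
apply: continuous_mul => //; apply: continuous_add => //; apply: continuous_opp.
exact: continuous_mul.
Qed.

Let cG_ i : continuous (G_ i).
Proof.
apply: continuous_mul => //; apply: continuous_add.
  by apply: continuous_add; exact: continuous_mul.
by apply: continuous_opp; apply: continuous_mul => //; exact: continuous_mul.
Qed.

Let bu : bbs u.
Proof.
apply: (@continuous_bbs _ _ _ N); first exact: continuous_mul.
by move=> x /vanishw[w0 _]; rewrite /u w0 mul0r.
Qed.

Let bw : bbs w.
Proof.
by apply: (@continuous_bbs _ _ _ N) => // x /vanishw[].
Qed.

Let bu_ i : bbs (u_ i).
Proof.
apply: (@continuous_bbs _ _ _ N) => // x /vanishw[w0 w_0].
by rewrite /u_ w0 w_0 !mul0r subr0 mul0r.
Qed.

Let bau_ i : bbs (fun x => `|u_ i x|).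
Proof.
apply: (@continuous_bbs _ _ _ N); first exact: continuous_normr.
by move=> x /vanishw[w0 w_0]; rewrite /u_ w0 w_0 !mul0r subr0 mul0r normr0.
Qed.

Let bG_ i : bbs (G_ i).
Proof.
apply: (@continuous_bbs _ _ _ N) => // x /vanishw[w0 w_0].
by rewrite /G_ w0 w_0 !mul0r subr0 addr0 mul0r.
Qed.

Let w0 x : 0 <= w x.
Proof. by rewrite mulr_ge0 ?sqr_ge0// cutoff_ge0. Qed.

Let N0 : 0 < N. Proof. exact: lt_le_trans N1. Qed.

Let II_G i : II (G_ i) = 0.
Proof.
apply: (@Rintegral_line_eq0 _ _ _ i) => // x.
apply: (line_partial_eq0 N0 (pG i)) => // y /vanishw_coord[wy w_y].
  by rewrite wy !mul0r.
by rewrite /G_ wy w_y !mul0r subr0 addr0 mul0r.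
Qed.

Let uxlnx x : u x * ln (u x) = (w x * ln (w x) - w x * V x) * rho x.
Proof.
have := w0 x; rewrite le_eqVlt /u => /predU1P[<-|wx]; first by rewrite !mul0r subrr mul0r.
by rewrite lnM ?posrE ?expR_gt0// expRK; ring.
Qed.

Let mu_II (f : 'rV[R]_d -> R) : measurable_fun setT f ->
  Rintegral mu setT f = II (fun x => f x * rho x).
Proof.
move=> mf; rewrite (@Rintegral_density _ _ _ (lebesgue_rV R d) mu rho)//.
  exact: continuous_measurable_rV.
by move=> x; exact: expR_ge0.
Qed.

Variables (delta c : R) (H : 'rV[R]_d -> R).
Hypotheses (delta0 : 0 < delta)
  (iF : mu.-integrable setT (fun x => (F x ^+ 2)%:E))
  (F1 : \int[mu]_x (F x ^+ 2) <= 1)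
  (iH : mu.-integrable setT (EFin \o H))
  (le_core : forall x, c * (w x * ln (w x)) - H x <= w x * ln (w x) - w x * V x -
    delta * (\sum_i `|w_ i x - w x * V_ i x|) -
    \sum_i (w_ i x * X_ i x + w x * Y_ i x - w x * X_ i x * V_ i x)).

Let mass_u : 0 <= II u <= 1.
Proof.
apply/andP; split.
  by apply: Rintegral_ge0 => x _; rewrite mulr_ge0// expR_ge0.
rewrite -(@mu_II w); last by case: bw.
apply: le_trans F1; apply: le_Rintegral => //; first exact: bbs_mu_integrable.
by move=> x _; rewrite ler_piMl ?sqr_ge0// cutoff_le1.
Qed.

(** Multiplied by [rho], the right side of [le_core] becomes u ln u - delta sum |u_i| - sum G_i. The
    G_i integrate to 0, and [le_line_entropy] with the line bounds |u_i| leaves at most d |ln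
    delta|. *)
Lemma le_truncated_entropy :
  mu.-integrable setT (fun x => (w x * ln (w x))%:E) /\
  c * \int[mu]_x (w x * ln (w x)) <= d%:R * `|ln delta| + \int[mu]_x H x.
Proof.
have bwl := bbs_xlnx bw w0.
have iwl := bbs_mu_integrable bwl.
split=> //.
pose Z x := w x * ln (w x) - w x * V x -
  \sum_i (delta * `|w_ i x - w x * V_ i x| +
  (w_ i x * X_ i x + w x * Y_ i x - w x * X_ i x * V_ i x)).
(* All of [Z] except w ln w is continuous with support in the box, hence integrable; w ln w is
   covered by [bbs_xlnx]. *)
have cS : continuous (fun x => w x * V x +
    \sum_i (delta * `|w_ i x - w x * V_ i x| +
    (w_ i x * X_ i x + w x * Y_ i x - w x * X_ i x * V_ i x))).
  apply: continuous_add; first exact: continuous_mul.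
  apply: continuous_sum => i; apply: continuous_add.
    apply: continuous_mul; first exact: continuous_cst.
    apply: continuous_normr; apply: continuous_add => //; apply: continuous_opp.
    exact: continuous_mul.
  apply: continuous_add.
    by apply: continuous_add; exact: continuous_mul.
  by apply: continuous_opp; apply: continuous_mul => //; exact: continuous_mul.
have bS : bbs (fun x => w x * V x +
    \sum_i (delta * `|w_ i x - w x * V_ i x| +
    (w_ i x * X_ i x + w x * Y_ i x - w x * X_ i x * V_ i x))).
  apply: (@continuous_bbs _ _ _ N) => // x /vanishw[wx w_x].
  rewrite wx mul0r add0r big1// => i _.
  by rewrite w_x !mul0r subr0 normr0 mulr0 subr0 !addr0.
have ZE x : Z x = w x * ln (w x) - (w x * V x +
    \sum_i (delta * `|w_ i x - w x * V_ i x| +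
    (w_ i x * X_ i x + w x * Y_ i x - w x * X_ i x * V_ i x))).
  by rewrite /Z opprD addrA.
have iZ : mu.-integrable setT (EFin \o Z).
  apply: eq_integrable (integrableB measurableT iwl (bbs_mu_integrable bS)) => //.
  by move=> x _; rewrite /= ZE.
have mZ : measurable_fun setT Z by case/integrableP: iZ => /measurable_EFinP.
have ZrE x : Z x * rho x = u x * ln (u x) -
    \sum_i (delta * `|u_ i x| + G_ i x).
  rewrite uxlnx /Z mulrBl; congr (_ - _); rewrite mulr_suml; apply: eq_bigr => i _.
  have r0 : 0 <= rho x := expR_ge0 _.
  by rewrite /u_ /G_ mulrDl [in RHS]normrM (ger0_norm r0) mulrA.
have iW i : (lebesgue_rV R d).-integrable setT (EFin \o (fun x => delta * `|u_ i x|)).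
  by under [EFin \o _]eq_fun do rewrite /= EFinM;
    apply: integrableZl => //; exact: (bbs_integrable (bau_ i)).
have iWG i : (lebesgue_rV R d).-integrable setT
    (EFin \o (fun x => delta * `|u_ i x| + G_ i x)).
  exact: (integrableD measurableT (iW i) (bbs_integrable (bG_ i))).
have [iSS SSE] := Rintegral_sum iWG.
have u0 x : 0 <= u x by rewrite mulr_ge0// expR_ge0.
have bul := bbs_xlnx bu u0.
have intZ : \int[mu]_x Z x <= d%:R * `|ln delta|.
  rewrite mu_II// (_ : (fun x => _) =
      fun x => u x * ln (u x) - \sum_i (delta * `|u_ i x| + G_ i x)); last exact/funext.
  rewrite RintegralB//; last exact: (bbs_integrable bul).
  rewrite SSE.
  have -> : \sum_i II (fun x => delta * `|u_ i x| + G_ i x) =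
      \sum_i (delta * II (fun x => `|u_ i x|)).
    apply: eq_bigr => i _; rewrite RintegralD//; last exact: (bbs_integrable (bG_ i)).
    by rewrite II_G addr0 RintegralZl//; exact: (bbs_integrable (bau_ i)).
  have uW i x : u x <= line (fun y => `|u_ i y|) i x.
    rewrite -[u x]ger0_norm//.
    apply: (le_line_partial (pu i)) => // y /vanishw_coord[wy _].
    by rewrite /u wy mul0r.
  have ent := le_line_entropy delta0 bu u0 bau_ (fun i x => normr_ge0 _) uW.
  rewrite lerBlDr; apply: le_trans ent _.
  have /andP[m0 m1] := mass_u.
  rewrite big_split/= addrCA addrC lerD2r.
  rewrite sumr_const card_ord.
  (* The mass m of u lies in [0, 1], so m ln m <= 0 and -ln delta m <= |ln delta|. *)
  rewrite -[leRHS]add0r; apply: lerD.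
    by rewrite mulr_ge0_le0// ln_le0.
  rewrite -[leLHS]mulr_natl ler_wpM2l ?ler0n// -mulNr.
  by rewrite -normrN (le_trans (ler_wpM2r m0 (ler_norm _)))// ler_piMr.
apply: le_trans (lerD intZ (lexx _)); rewrite -lerBlDr -RintegralZl// -RintegralB//; last first.
  by under [EFin \o _]eq_fun do rewrite /= EFinM; exact: integrableZl.
apply: le_Rintegral => //.
  have iwl' : mu.-integrable setT (EFin \o (fun x => c * (w x * ln (w x)))).
    by under [EFin \o _]eq_fun do rewrite /= EFinM; exact: integrableZl.
  exact: (integrableB measurableT iwl' iH).
move=> x _; apply: le_trans (le_core x) _; rewrite /Z [X in _ <= _ - X]big_split/= -mulr_sumr.
by rewrite opprD [leRHS]addrA.
Qed.

End truncated.

Variables (delta c : R) (H : 'rV[R]_d -> R).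
Hypotheses (delta0 : 0 < delta) (c0 : 0 < c)
  (iF : mu.-integrable setT (fun x => (F x ^+ 2)%:E))
  (F1 : \int[mu]_x (F x ^+ 2) <= 1)
  (iH : mu.-integrable setT (EFin \o H))
  (le_core : forall (x : 'rV[R]_d) (theta : R) (g : 'I_d -> R), 0 <= theta <= 1 ->
    (forall i, g i ^+ 2 <= 16 * theta) ->
    (forall i, `|x ord0 i * g i| <= 4) ->
    let w := theta * F x ^+ 2 in
    let w_ i := g i * F x ^+ 2 + theta * (2 * F x * F_ i x) in
    c * (w * ln w) - H x <= w * ln w - w * V x -
    delta * (\sum_i `|w_ i - w * V_ i x|) -
    \sum_i (w_ i * X_ i x + w * Y_ i x - w * X_ i x * V_ i x)).

(** [le_core] sees the cutoff only through a value [theta] and slopes [g], so one [H] serves every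
    radius and the truncated entropies share the bound [M]. Fatou's lemma is applied to w ln w + 1
    >= 0; the added 1 has integral 1 since [mu] is a probability. *)
Lemma le_entropy : mu.-integrable setT (fun x => (F x ^+ 2 * ln (F x ^+ 2))%:E) /\
  c * \int[mu]_x (F x ^+ 2 * ln (F x ^+ 2)) <= d%:R * `|ln delta| + \int[mu]_x H x.
Proof.
pose w (k : nat) x := cutoff k.+1%:R x * F x ^+ 2.
pose M := (d%:R * `|ln delta| + \int[mu]_x H x) / c.
have iw k : mu.-integrable setT (fun x => (w k x * ln (w k x))%:E) /\
    \int[mu]_x (w k x * ln (w k x)) <= M.
  have N1 : 1 <= k.+1%:R :> R by rewrite ler1n.
  have [|i1 i2] := le_truncated_entropy N1 delta0 iF F1 iH (c := c).
    move=> x; apply: le_core.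
    - by rewrite cutoff_ge0 cutoff_le1.
    - by move=> i; exact: dcutoff_sqr_le.
    - by move=> i; exact: coord_dcutoff_le.
  by split=> //; rewrite ler_pdivlMr// mulrC.
pose e x := F x ^+ 2 * ln (F x ^+ 2).
have w0 k x : 0 <= w k x by rewrite mulr_ge0 ?sqr_ge0// cutoff_ge0.
have ge_1 a : 0 <= a -> 0 <= a * ln a + 1 :> R.
  by move=> /xlnx_ge; lra.
have cvgw x : (w k x * ln (w k x) + 1)%:E @[k --> \oo] --> (e x + 1)%:E.
  apply: cvg_EFin; first exact: nearW.
  rewrite (_ : fine \o _ = fun k => w k x * ln (w k x) + 1)//.
  apply: cvgD; last exact: cvg_cst.
  (* Zeros of F are treated apart because [ln] is not continuous at 0. *)
  have := sqr_ge0 (F x); rewrite /e /w le_eqVlt => /predU1P[<-|a0].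
    rewrite mul0r; under eq_fun do rewrite mulr0 mul0r; exact: cvg_cst.
  have cw : cutoff k.+1%:R x * F x ^+ 2 @[k --> \oo] --> F x ^+ 2.
    rewrite -[X in _ --> X]mul1r; apply: cvgM; last exact: cvg_cst.
    exact: cvg_cutoff.
  apply: cvgM => //; apply: (@continuous_cvg _ _ _ _ _ _ (@ln R)) => //.
  exact: continuous_ln.
have mw k : measurable_fun setT (fun x => (w k x * ln (w k x) + 1)%:E).
  apply/measurable_EFinP; apply: measurable_funD; last exact: measurable_cst.
  by apply/measurable_EFinP; have [/integrableP[]] := iw k.
have wk0 k x : setT x -> (0 <= (w k x * ln (w k x) + 1)%:E)%E.
  by move=> _; rewrite lee_fin ge_1.
have mFF : measurable_fun setT (fun x => F x ^+ 2).
  by apply/measurable_EFinP; case/integrableP: iF.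
have me : measurable_fun setT e.
  apply: measurable_funM => //; apply: measurableT_comp => //; exact: measurable_ln.
have i1 : mu.-integrable setT (fun=> 1%:E).
  exact: finite_measure_integrable_cst.
have R1 : \int[mu]_x 1 = 1 :> R.
  rewrite Rintegral_cst// mul1r; exact: (congr1 fine (@probability_setT _ _ _ mu)).
have bound : (\int[mu]_x (e x + 1)%:E <= (M + 1)%:E)%E.
  have := @fatou _ _ _ mu setT measurableT _ mw wk0.
  rewrite (eq_integral (fun x => (e x + 1)%:E)); last first.
    by move=> x _; exact: (cvg_limn_einf_sup (cvgw x)).1.
  move=> /le_trans; apply; rewrite limn_einf_lim; apply: lime_le.
    exact: is_cvg_einfs.
  apply: nearW => k; apply: (@le_trans _ _ (\int[mu]_x (w k x * ln (w k x) + 1)%:E)%E).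
    by apply: ereal_inf_lbound; exists k => /=.
  have [iwk wkM] := iw k.
  have iw1 := integrableD measurableT iwk i1.
  have : \int[mu]_x (w k x * ln (w k x) + 1) <= M + 1 by rewrite RintegralD// R1 lerD2r.
  by rewrite -lee_fin /Rintegral fineK//; exact: integrable_fin_num.
have e0 x : (0 <= (e x + 1)%:E)%E by rewrite lee_fin ge_1 ?sqr_ge0.
have ie1 : mu.-integrable setT (fun x => (e x + 1)%:E).
  apply/integrableP; split.
    by apply/measurable_EFinP; apply: measurable_funD => //; exact: measurable_cst.
  under eq_integral do rewrite gee0_abs//.
  by apply: le_lt_trans bound _; rewrite ltry.
have ie : mu.-integrable setT (EFin \o e).
  apply: eq_integrable (integrableB measurableT ie1 i1) => // x _.
  by rewrite /= -EFinB addrK.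
split=> //; rewrite mulrC -ler_pdivlMr// -/M.
have : \int[mu]_x (e x + 1) <= M + 1.
  by rewrite -lee_fin /Rintegral fineK//; exact: integrable_fin_num.
by rewrite RintegralD// R1 lerD2r.
Qed.

End core.

(** * Scalar inequalities *)

Section scalar_inequalities.
Context (R : realType).
Implicit Types (a b w y : R).

(** From 1 + z <= exp z at z = b - ln w, multiplied by w. *)
Lemma young_entropy w b : 0 <= w -> w * b <= w * ln w + expR b.
Proof.
rewrite le_eqVlt => /predU1P[<-|w0]; first by rewrite !mul0r add0r expR_ge0.
have := @expR_ge1Dx R (b - ln w); rewrite expRB lnK ?posrE// => h.
have := ler_wpM2l (ltW w0) h; rewrite mulrCA divff ?gt_eqF// mulr1.
nra.
Qed.

Lemma ln_eD_ge1 w : 0 <= w -> 1 <= ln (expR 1 + w).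
Proof.
move=> w0; rewrite -[leLHS](@expRK R) ler_ln ?posrE ?ltr_wpDr ?expR_gt0//.
by rewrite lerDl.
Qed.

(** Factor e + w = w (1 + e/w) and use ln (1 + e/w) <= e/w. *)
Lemma xln_eD_le w : 0 <= w -> w * ln (expR 1 + w) <= w * ln w + expR 1.
Proof.
rewrite le_eqVlt => /predU1P[<-|w0]; first by rewrite !mul0r add0r expR_ge0.
have e0 : 0 < expR 1 / w by rewrite divr_gt0// expR_gt0.
have -> : expR 1 + w = w * (1 + expR 1 / w).
  by rewrite mulrDr mulr1 mulrCA divff ?gt_eqF// mulr1 addrC.
rewrite lnM ?posrE//; last by rewrite addr_gt0.
rewrite mulrDr lerD2l.
have : ln (1 + expR 1 / w) <= expR 1 / w.
  rewrite -[leRHS](@expRK R) ler_ln ?posrE ?expR_gt0 ?addr_gt0//.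
  exact: expR_ge1Dx.
by rewrite -(ler_pM2l w0) mulrCA divff ?gt_eqF// mulr1.
Qed.

Lemma le_powR_expR (eta y : R) (p : R) : 0 < eta -> 0 <= y -> 0 <= p <= 2 ->
  y `^ p <= (1 + 16 / eta ^+ 2) * expR (eta / 2 * y).
Proof.
move=> eta0 y0 /andP[p0 p2].
have h : y `^ p <= 1 + y ^+ 2.
  have [y1|/ltW y1] := leP y 1.
    have : y `^ p <= 1 `^ p by apply: ge0_ler_powR; rewrite ?nnegrE.
    by rewrite powR1 => /le_trans; apply; rewrite lerDl sqr_ge0.
  by apply: le_trans (ler_powR y1 p2) _; rewrite (powR_mulrn 2)// lerDr.
apply: le_trans h _; rewrite mulrDl mul1r; apply: lerD.
  by have := @expR_ge1Dx R (eta / 2 * y); apply: le_trans; rewrite lerDl mulr_ge0// divr_ge0// ltW.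
(* The constant 16/eta^2 comes from y^2 = 16/eta^2 (eta y/4)^2, where eta y/4 <= exp (eta y/4). *)
have -> : expR (eta / 2 * y) = expR (eta / 4 * y) ^+ 2.
  by rewrite expr2 -expRD; congr expR; field.
have h := @expR_ge1Dx R (eta / 4 * y).
have z0 : 0 <= eta / 4 * y by rewrite mulr_ge0// divr_ge0// ltW.
have -> : y ^+ 2 = 16 / eta ^+ 2 * (eta / 4 * y) ^+ 2 by field; rewrite gt_eqF.
rewrite ler_wpM2l ?divr_ge0 ?sqr_ge0// !expr2; nra.
Qed.

(** Absorbs w |x|^2 / L into the exponential moment and the entropy. With y = r^alpha, p = 2/alpha
    and l = ln (e + w), the quotient is y^p / l^(p-1): the exponent p - 1 is the one that leaves a
    single power of l when y is of order l. *)
Lemma le_sqr_div_powR_ln (alpha eta r w : R) : 1 < alpha <= 2 -> 0 < eta ->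
  0 <= r -> 0 <= w ->
  w * (r ^+ 2 / ln (expR 1 + w) `^ (2 / alpha - 1)) <=
  (1 + 16 / eta ^+ 2) * expR (eta * r `^ alpha) +
  (2 / eta) `^ (2 / alpha) * (w * ln (expR 1 + w)).
Proof.
move=> /andP[a1 a2] eta0 r0 w0; set l := ln _; set p := 2 / alpha; set y := r `^ alpha.
have al0 : 0 < alpha by rewrite (lt_trans _ a1).
have l1 : 1 <= l by exact: ln_eD_ge1.
have y0 : 0 <= y by exact: powR_ge0.
have p1 : 1 <= p by rewrite ler_pdivlMr// mul1r.
have p2 : p <= 2 by rewrite ler_pdivrMr//; nra.
have p0 : 0 <= p by rewrite (le_trans ler01).
have ry : r ^+ 2 = y `^ p.
  by rewrite /y -powRrM mulrCA divff ?gt_eqF// mulr1 (powR_mulrn 2).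
have lp1 : 1 <= l `^ (p - 1) by rewrite -[leLHS](powRr0 l) ler_powR// subr_ge0.
have lp0 : 0 < l `^ (p - 1) by rewrite (lt_le_trans ltr01).
have c1 : 0 <= 1 + 16 / eta ^+ 2 by rewrite addr_ge0// divr_ge0// sqr_ge0.
(* If l <= eta y/2, then w and y^p are both bounded by multiples of exp (eta y/2), whose square is
   the exponential moment. Otherwise y <= 2 l/eta, and y^p / l^(p-1) is at most (2/eta)^p l. *)
rewrite ry; have [h|/ltW h] := leP l (eta / 2 * y).
  rewrite -[leLHS]addr0; apply: lerD; last first.
    by rewrite mulr_ge0 ?powR_ge0// mulr_ge0// (le_trans ler01).
  have we : w <= expR (eta / 2 * y).
    rewrite -ler_expR in h; apply: le_trans h; rewrite lnK ?posrE.
      by rewrite lerDr expR_ge0.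
    by rewrite ltr_wpDr// expR_gt0.
  apply: (@le_trans _ _ (expR (eta / 2 * y) * ((1 + 16 / eta ^+ 2) * expR (eta / 2 * y)))).
    apply: ler_pM => //; first by rewrite divr_ge0 ?powR_ge0.
    apply: (@le_trans _ _ (y `^ p)).
      by rewrite ler_pdivrMr// ler_peMr// powR_ge0.
    by apply: le_powR_expR; rewrite ?p0.
  rewrite mulrCA -expRD ler_wpM2l// ler_expR -mulrDl.
  by rewrite (_ : eta / 2 + eta / 2 = eta)//; field.
rewrite -[leLHS]add0r; apply: lerD; first by rewrite mulr_ge0 ?expR_ge0.
rewrite [leRHS]mulrCA ler_wpM2l// ler_pdivrMr// -mulrA mulr_powRB1; last 2 first.
  by rewrite (le_trans ler01).
  by rewrite (lt_le_trans ltr01).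
rewrite -powRM; last 2 first.
  by rewrite divr_ge0// ltW.
  by rewrite (le_trans ler01).
apply: ge0_ler_powR; rewrite ?nnegrE//.
  by rewrite mulr_ge0 ?divr_ge0 ?(le_trans ler01 l1)// ltW.
by rewrite -ler_pdivrMl ?divr_gt0// invf_div.
Qed.

(** * Pointwise bounds on one partial derivative of w = theta F^2 *)

Section cutoff_terms.
Variables (theta g F G : R).
Hypotheses (theta01 : 0 <= theta <= 1) (g_theta : g ^+ 2 <= 16 * theta).
Let w := theta * F ^+ 2.
Let w' := g * F ^+ 2 + theta * (2 * F * G).

Let F20 : 0 <= F ^+ 2. Proof. exact: sqr_ge0. Qed.
Let G20 : 0 <= G ^+ 2. Proof. exact: sqr_ge0. Qed.

Let g4 : `|g| <= 4.
Proof.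
case/andP: theta01 => t0 t1; rewrite -(@ler_pXn2r _ 2) ?nnegrE//.
by rewrite real_normK ?num_real//; apply: le_trans g_theta _; lra.
Qed.

Let FG : `|F * G| <= (F ^+ 2 + G ^+ 2) / 2.
Proof.
rewrite ler_norml; apply/andP; split.
  by have := sqr_ge0 (F + G); rewrite sqrrD; lra.
by have := sqr_ge0 (F - G); rewrite sqrrB; lra.
Qed.

Lemma le_norm_partial : `|w'| <= 5 * F ^+ 2 + G ^+ 2.
Proof.
case/andP: theta01 => t0 t1; apply: le_trans (ler_normD _ _) _.
rewrite [`|g * _|]normrM (ger0_norm F20) [`|theta * _|]normrM (ger0_norm t0).
rewrite -[2 * _ * _]mulrA [`|2 * _|]normrM normr_nat.
have h1 : `|g| * F ^+ 2 <= 4 * F ^+ 2 by rewrite ler_wpM2r.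
have h2 : theta * (2 * `|F * G|) <= 2 * `|F * G| by rewrite ler_piMl ?mulr_ge0.
by move: h1 h2 FG; lra.
Qed.

(** The cutoff part is bounded through y g. The rest is a weighted Young inequality, the square of
    lam F y - C G L over lam L: it puts the weight L on G^2 and 1/L on y^2. *)
Lemma le_coord_partial (y L lam C : R) : `|y * g| <= 4 -> 1 <= L -> 0 < lam ->
  C * (w' * y) <= 4 * `|C| * F ^+ 2 + lam * (w * (y ^+ 2 / L)) + C ^+ 2 / lam * (G ^+ 2 * L).
Proof.
case/andP: theta01 => t0 t1 yg L1 lam0.
have L0 : 0 < L by rewrite (lt_le_trans _ L1).
have -> : C * (w' * y) = C * (y * g) * F ^+ 2 + theta * (2 * C * (F * y) * G).
  by rewrite /w'; ring.
rewrite -addrA; apply: lerD.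
  rewrite ler_wpM2r// (le_trans (ler_norm _))// normrM [4 * _]mulrC.
  by rewrite ler_wpM2l.
have key : 2 * C * (F * y) * G <= lam * (F ^+ 2 * (y ^+ 2 / L)) + C ^+ 2 / lam * (G ^+ 2 * L).
  have : 0 <= (lam * (F * y) - C * G * L) ^+ 2 / (lam * L).
    by rewrite divr_ge0 ?sqr_ge0// mulr_ge0 ?ltW.
  rewrite (_ : _ / (lam * L) = lam * (F ^+ 2 * (y ^+ 2 / L)) +
    C ^+ 2 / lam * (G ^+ 2 * L) - 2 * C * (F * y) * G); first by rewrite subr_ge0.
  by field; rewrite !gt_eqF.
apply: le_trans (ler_wpM2l t0 key) _; rewrite mulrDr; apply: lerD.
  by rewrite [leLHS](_ : _ = lam * (w * (y ^+ 2 / L)))// /w; ring.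
apply: ler_piMl => //; apply: mulr_ge0; first by rewrite divr_ge0 ?sqr_ge0// ltW.
by apply: mulr_ge0 => //; exact: ltW.
Qed.

(** Half of t w v^2 is spent, a quarter on each part of w' v. For the cutoff part g v, the square of
    t g v/4 - 8 combined with g^2 <= 16 theta gives the constant 16/t. *)
Lemma le_gradient_partial (t v : R) : 0 < t ->
  w' * v - t * (w * v ^+ 2) <=
  16 / t * F ^+ 2 + 4 / t * G ^+ 2 - t / 2 * (w * v ^+ 2).
Proof.
case/andP: theta01 => th0 th1 t0.
have k1 : g * v <= t / 4 * (theta * v ^+ 2) + 16 / t.
  rewrite -(ler_pM2l (_ : 0 < 4 * t)) ?mulr_gt0//.
  rewrite (_ : 4 * t * (_ + _) = t ^+ 2 * (theta * v ^+ 2) + 64); last by field; rewrite gt_eqF.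
  have h1 := sqr_ge0 (t * g * v / 4 - 8).
  have h2 : t ^+ 2 * v ^+ 2 * g ^+ 2 <= t ^+ 2 * v ^+ 2 * (16 * theta).
    by rewrite ler_wpM2l// mulr_ge0 ?sqr_ge0.
  rewrite (_ : _ ^+ 2 = t ^+ 2 * v ^+ 2 * g ^+ 2 / 16 + 64 - 4 * t * (g * v)) in h1; last by field.
  lra.
have k2 : 2 * F * G * v <= t / 4 * (F ^+ 2 * v ^+ 2) + 4 / t * G ^+ 2.
  rewrite -(ler_pM2l (_ : 0 < 4 * t)) ?mulr_gt0//.
  rewrite (_ : 4 * t * (_ + _) = t ^+ 2 * (F ^+ 2 * v ^+ 2) + 16 * G ^+ 2); last by field; rewrite gt_eqF.
  by rewrite -subr_ge0 (_ : _ - _ = (t * (F * v) - 4 * G) ^+ 2) ?sqr_ge0//; ring.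
have k3 : 0 <= 4 / t * G ^+ 2 by rewrite mulr_ge0// divr_ge0// ltW.
have := ler_wpM2l F20 k1; have := ler_wpM2l th0 k2.
have := ler_piMl k3 th1; rewrite /w' /w !mulrDr.
set A := t / 4; have -> : t / 2 = 2 * A by rewrite /A; field.
have -> : t = 4 * A by rewrite /A; field.
move: A (4 / _) (16 / _) => A B C; nra.
Qed.

Lemma le_density_partial (v : R) : `|w' - w * v| <= 6 * F ^+ 2 + G ^+ 2 + w * v ^+ 2.
Proof.
case/andP: theta01 => t0 t1; apply: le_trans (ler_normB _ _) _.
have w0 : 0 <= w by rewrite mulr_ge0.
have wF : w <= F ^+ 2 by rewrite ler_piMl.
have h : `|w * v| <= w + w * v ^+ 2.
  rewrite normrM (ger0_norm w0) -[X in X + _]mulr1 -mulrDr ler_wpM2l//.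
  have := sqr_ge0 (`|v| - 1); rewrite sqrrB real_normK ?num_real// expr1n mulr1.
  by have := sqr_ge0 v; lra.
by have := le_norm_partial; lra.
Qed.

End cutoff_terms.

End scalar_inequalities.

(** * From a pointwise inequality to a functional inequality with weight [l] *)

Section reduction.
Context (R : realType) (d : nat) (V : 'rV[R]_d -> R) (mu : probability 'rV[R]_d R).
Hypothesis mu_density : forall A : set 'rV[R]_d, measurable A ->
  mu A = (\int[lebesgue_rV R d]_(x in A) (expR (- V x))%:E)%E.

Lemma Ck1_continuous (f : 'rV[R]_d -> R) : Ck 1 f ->
  [/\ continuous f, forall i, continuous (partial i f) &
      forall i, is_partial i f (partial i f)].
Proof.
move=> [df cf]; split=> // [x|i]; first exact: differentiable_continuous.
exact: differentiable_is_partial.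
Qed.

Lemma enorm_sqr (x : 'rV[R]_d) : enorm x ^+ 2 = \sum_i x ord0 i ^+ 2.
Proof. by rewrite sqr_sqrtr ?dotp_ge0//; apply: eq_bigr => i _; rewrite expr2. Qed.

Variables (X_ Y_ : 'I_d -> 'rV[R]_d -> R) (l : R -> R) (K : 'rV[R]_d -> R)
  (delta c A B : R).
Hypotheses (V1 : Ck 1 V)
  (cX_ : forall i, continuous (X_ i)) (cY_ : forall i, continuous (Y_ i))
  (pX : forall i, is_partial i (X_ i) (Y_ i))
  (ml : measurable_fun setT l) (l0 : forall a, 0 <= a -> 0 <= l a)
  (iK : mu.-integrable setT (EFin \o K))
  (delta0 : 0 < delta) (c0 : 0 < c) (B0 : 0 < B)
  (le_core : forall (x : 'rV[R]_d) (F theta : R) (G g : 'I_d -> R),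
    0 <= theta <= 1 -> (forall i, g i ^+ 2 <= 16 * theta) ->
    (forall i, `|x ord0 i * g i| <= 4) ->
    let w := theta * F ^+ 2 in
    let w_ i := g i * F ^+ 2 + theta * (2 * F * G i) in
    c * (w * ln w) - (A * F ^+ 2 + B * (\sum_i G i ^+ 2 * l (F ^+ 2)) + K x) <=
    w * ln w - w * V x - delta * (\sum_i `|w_ i - w * partial i V x|) -
    \sum_i (w_ i * X_ i x + w * Y_ i x - w * X_ i x * partial i V x)).

Let A' := (d%:R * `|ln delta| + A + \int[mu]_x K x) / c.

(** [le_entropy] for F = f / sqrt N with N the integral of f^2, rescaled by N. The weight [l] is
    constant for log-Sobolev and a power of ln (e + a) for I(tau). *)
Lemma le_Ent (f : 'rV[R]_d -> R) : admissible mu f ->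
  (Ent mu (fun x => f x ^+ 2)%R <= A'%:E * \int[mu]_x (f x ^+ 2)%:E +
   (B / c)%:E * \int[mu]_x (enorm (grad f x) ^+ 2 *
     l (f x ^+ 2 / (\int[mu]_y (f y ^+ 2))%R))%:E)%E.
Proof.
move=> [/(_ 1%N)/Ck1_continuous[cf cf_ pf] if2].
have [cV cV_ pV] := Ck1_continuous V1.
set N := (\int[mu]_y (f y ^+ 2))%R.
have NE : (\int[mu]_x (f x ^+ 2)%:E = N%:E)%E.
  by rewrite /N /Rintegral fineK//; exact: integrable_fin_num.
have N0 : 0 <= N by apply: Rintegral_ge0 => x _; exact: sqr_ge0.
rewrite NE /Ent -/N.
pose gr x := enorm (grad f x) ^+ 2 * l (f x ^+ 2 / N).
have gr0 x : 0 <= gr x.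
  by rewrite mulr_ge0 ?sqr_ge0// l0// divr_ge0 ?sqr_ge0.
rewrite -[X in (_ <= _ + _ * X)%E]/(\int[mu]_x (gr x)%:E)%E.
have Gr0 : (0 <= \int[mu]_x (gr x)%:E)%E by apply: integral_ge0 => x _; rewrite lee_fin.
have Bc0 : 0 < B / c by rewrite divr_gt0.
move: N0; rewrite le_eqVlt => /predU1P[N0|N0].
  (* For N = 0 the conventions f^2 / 0 = 0 and ln 0 = 0 make the entropy integrand vanish. *)
  rewrite -N0 mule0 add0e (eq_integral (fun=> 0%E)); last first.
    by move=> x _; rewrite invr0 mulr0 ln0// mulr0.
  by rewrite integral0; apply: mule_ge0 => //; rewrite lee_fin ltW.
(* An infinite gradient term makes the right side +oo because B / c > 0; otherwise [gr] is
   integrable and may enter [H]. *)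
have [Groo|Grfin] := eqVneq (\int[mu]_x (gr x)%:E)%E +oo%E.
  by rewrite Groo gt0_muley ?lte_fin// addey// leey.
pose s := (Num.sqrt N)^-1.
have s2 : s ^+ 2 = N^-1 by rewrite exprVn sqr_sqrtr// ltW.
pose F x := s * f x; pose F_ i x := s * partial i f x.
have F2 x : F x ^+ 2 = f x ^+ 2 / N by rewrite exprMn s2 mulrC.
have cF : continuous F by apply: continuous_mul => //; exact: continuous_cst.
have cF_ i : continuous (F_ i) by apply: continuous_mul => //; exact: continuous_cst.
have pF i : is_partial i F (F_ i).
  apply: (is_partial_eq (is_partialM (is_partial_cst i s) (pf i))) => x //.
  by rewrite mul0r add0r.
have igr : mu.-integrable setT (EFin \o gr).
  apply/integrableP; split.
    apply/measurable_EFinP; apply: measurable_funM.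
      under eq_fun do rewrite enorm_sqr.
      apply: continuous_measurable_rV; apply: continuous_sum => i.
      rewrite (_ : (fun x => _) = fun x => partial i f x * partial i f x).
        exact: continuous_mul.
      by apply/funext => x; rewrite mxE expr2.
    apply: (measurableT_comp ml); apply: continuous_measurable_rV.
    apply: continuous_mul; last exact: continuous_cst.
    exact: continuous_mul.
  under eq_integral do rewrite gee0_abs ?lee_fin//.
  by rewrite ltey.
have iF : mu.-integrable setT (fun x => (F x ^+ 2)%:E).
  under eq_fun do rewrite F2 mulrC EFinM.
  exact: integrableZl.
have IF : \int[mu]_x (F x ^+ 2) = 1.
  under eq_Rintegral do rewrite F2 mulrC.
  by rewrite RintegralZl// mulVf// gt_eqF.
have GE x : \sum_i F_ i x ^+ 2 * l (F x ^+ 2) = N^-1 * gr x.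
  rewrite /gr enorm_sqr -mulr_suml F2 mulrA mulr_sumr; congr (_ * _).
  by apply: eq_bigr => i _; rewrite exprMn s2 mxE.
have iNgr : mu.-integrable setT (EFin \o (fun x => B / N * gr x)).
  by under [EFin \o _]eq_fun do rewrite /= EFinM; exact: integrableZl.
have iAF : mu.-integrable setT (EFin \o (fun x => A * F x ^+ 2)).
  by under [EFin \o _]eq_fun do rewrite /= EFinM; exact: integrableZl.
have iAB : mu.-integrable setT (EFin \o (fun x => A * F x ^+ 2 + B / N * gr x)).
  exact: (integrableD measurableT iAF iNgr).
pose H x := A * F x ^+ 2 + B / N * gr x + K x.
have iH : mu.-integrable setT (EFin \o H).
  exact: (integrableD measurableT iAB iK).
have IH : \int[mu]_x H x = A + B / N * \int[mu]_x gr x + \int[mu]_x K x.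
  by rewrite RintegralD// RintegralD// !RintegralZl// IF mulr1.
have IF1 : \int[mu]_x (F x ^+ 2) <= 1 by rewrite IF.
have [|ie le_e] := le_entropy mu_density cV cV_ pV cF cF_ pF cX_ cY_ pX delta0 c0 iF
    IF1 iH.
  move=> x theta g t01 g1 g2 /=; have := @le_core x (F x) theta (F_ ^~ x) g t01 g1 g2.
  by rewrite /= GE [B * _]mulrA; apply.
rewrite IH in le_e.
rewrite (eq_integral (fun x => N%:E * (F x ^+ 2 * ln (F x ^+ 2))%:E)%E); last first.
  by move=> x _; rewrite -EFinM F2 mulrA [N * _]mulrC divfK ?gt_eqF.
rewrite integralZl// -[X in (N%:E * X)%E]fineK; last exact: integrable_fin_num.
rewrite -[X in (_ <= _ + _ * X)%E]fineK; last exact: integrable_fin_num.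
rewrite -!EFinM -EFinD lee_fin -/(Rintegral _ _ _) -/(Rintegral _ _ _).
rewrite -(ler_pM2l c0) mulrCA.
apply: le_trans (ler_wpM2l (ltW N0) le_e) _.
rewrite /A' le_eqVlt; apply/orP; left; apply/eqP; field.
by rewrite !gt_eqF.
Qed.

End reduction.

(** * The two criteria *)

Section parts.
Context (R : realType) (d : nat) (V : 'rV[R]_d -> R) (mu : probability 'rV[R]_d R).
Hypothesis mu_density : forall A : set 'rV[R]_d, measurable A ->
  mu A = (\int[lebesgue_rV R d]_(x in A) (expR (- V x))%:E)%E.

(** Divided by e^(-V), the divergence of w (grad V / s) e^(-V) is (<grad w, grad V> + w lap V - w
    |grad V|^2) / s. Added to the bound on w V, it leaves (<grad w, grad V> - t w |grad V|^2) / s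
    plus a multiple of F^2. *)
Lemma log_sobolev_of_curvature (s t C : R) : Ck 2 V -> 0 < s -> 0 < t < 1 ->
  (forall x, s * V x <= (1 - t) * enorm (grad V x) ^+ 2 - laplacian V x + C) ->
  defective_log_sobolev mu.
Proof.
move=> V2 s0 /andP[t0 _] hV.
have V1 : Ck 1 V.
  case: V2 => dV V1; split=> // i; have [dVi _] := V1 i.
  by move=> x; exact: differentiable_continuous.
have pV i : Ck 1 (partial i V) by have [_] := V2; apply.
(* [le_gradient_partial] leaves -t/(2s) w v^2; this [delta] consumes half of it through
   [le_density_partial]. [P] and [B] collect the coefficients of F^2 and G^2 in these two bounds. *)
pose delta := t / (4 * s).
pose P := 16 / t / s + 6 * delta; pose B := 4 / t / s + delta.
have delta0 : 0 < delta by apply: divr_gt0 => //; exact: mulr_gt0.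
have B0 : 0 < B by apply: addr_gt0 => //; apply: divr_gt0 => //; exact: divr_gt0.
pose X_ i x := s^-1 * partial i V x; pose Y_ i x := s^-1 * partial i (partial i V) x.
have cX_ i : continuous (X_ i).
  by apply: continuous_mul; [exact: continuous_cst|have [] := Ck1_continuous (pV i)].
have cY_ i : continuous (Y_ i).
  apply: continuous_mul; first exact: continuous_cst.
  by have [_ h _] := Ck1_continuous (pV i); exact: h.
have pX i : is_partial i (X_ i) (Y_ i).
  have [_ _ h] := Ck1_continuous (pV i).
  apply: (is_partial_eq (is_partialM (is_partial_cst i s^-1) (h i))) => x //.
  by rewrite mul0r add0r.
have i0 : mu.-integrable setT (EFin \o (fun=> 0)) by exact: integrable0.
pose A := d%:R * P + `|C| / s.
have core (x : 'rV[R]_d) (F theta : R) (G g : 'I_d -> R) :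
    0 <= theta <= 1 -> (forall i, g i ^+ 2 <= 16 * theta) ->
    (forall i, `|x ord0 i * g i| <= 4) ->
    let w := theta * F ^+ 2 in
    let w_ i := g i * F ^+ 2 + theta * (2 * F * G i) in
    1 * (w * ln w) - (A * F ^+ 2 + B * (\sum_i G i ^+ 2 * 1) + 0) <=
    w * ln w - w * V x - delta * (\sum_i `|w_ i - w * partial i V x|) -
    \sum_i (w_ i * X_ i x + w * Y_ i x - w * X_ i x * partial i V x).
  move=> t01 gt _; have /andP[th0 th1] := t01.
  pose w := theta * F ^+ 2; pose w_ i := g i * F ^+ 2 + theta * (2 * F * G i).
  suff : 1 * (w * ln w) - (A * F ^+ 2 + B * (\sum_i G i ^+ 2 * 1) + 0) <=
    w * ln w - w * V x - delta * (\sum_i `|w_ i - w * partial i V x|) -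
    \sum_i (w_ i * X_ i x + w * Y_ i x - w * X_ i x * partial i V x) by [].
  pose v i := partial i V x; pose y i := partial i (partial i V) x.
  have F20 : 0 <= F ^+ 2 := sqr_ge0 F.
  have w0 : 0 <= w by rewrite mulr_ge0.
  have wF : w <= F ^+ 2 by rewrite ler_piMl.
  have {}hV : w * V x <= w / s * ((1 - t) * (\sum_i v i ^+ 2) - \sum_i y i) + `|C| / s * F ^+ 2.
    apply: (@le_trans _ _ (w / s * ((1 - t) * (\sum_i v i ^+ 2) - \sum_i y i + C))).
      rewrite -mulrA ler_wpM2l// mulrC ler_pdivlMr// mulrC.
      have := hV x; rewrite enorm_sqr /laplacian.
      by under eq_bigr do rewrite mxE.
    rewrite mulrDr lerD2l; apply: (@le_trans _ _ (`|C| / s * w)).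
      rewrite [leLHS]mulrC [leRHS](_ : _ = `|C| * (w / s)); last by ring.
      by rewrite ler_wpM2r ?ler_norm// divr_ge0// ltW.
    by rewrite ler_wpM2l// divr_ge0// ltW.
  have term i : s^-1 * (w_ i * v i - t * (w * v i ^+ 2)) +
      delta * `|w_ i - w * v i| <= P * F ^+ 2 + B * G i ^+ 2.
    have h1 := le_gradient_partial F (G i) t01 (gt i) (v i) t0.
    have h2 := le_density_partial F (G i) t01 (gt i) (v i).
    have si0 : 0 <= s^-1 by rewrite invr_ge0 ltW.
    apply: le_trans (lerD (ler_wpM2l si0 h1) (ler_wpM2l (ltW delta0) h2)) _.
    have q0 : 0 <= delta * (w * v i ^+ 2).
      by apply: mulr_ge0; [exact: ltW|rewrite mulr_ge0 ?sqr_ge0].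
    rewrite -subr_ge0 [X in 0 <= X](_ : _ = delta * (w * v i ^+ 2))//.
    by rewrite /P /B /delta /w; field; rewrite !gt_eqF.
  have := ler_sum (index_enum 'I_d) (P := xpredT) (fun i _ => term i).
  rewrite big_split/= [X in _ <= X -> _]big_split/= sumr_const card_ord -mulr_sumr.
  rewrite -[P * _ *+ d]mulr_natl -!mulr_sumr.
  (* The second derivatives [y i] of the divergence cancel those of the bound on w V. *)
  have -> : \sum_i (w_ i * v i - t * (w * v i ^+ 2)) = \sum_i (w_ i * v i + w * y i - w * v i ^+ 2)
      + w * ((1 - t) * (\sum_i v i ^+ 2) - \sum_i y i).
    rewrite mulrBr mulrA !mulr_sumr -sumrB -big_split/=; apply: eq_bigr => i _; ring.
  have -> : \sum_i (w_ i * X_ i x + w * Y_ i x - w * X_ i x * partial i V x) =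
      s^-1 * \sum_i (w_ i * v i + w * y i - w * v i ^+ 2).
    rewrite mulr_sumr; apply: eq_bigr => i _; rewrite /X_ /Y_ -/(v i) -/(y i); ring.
  under [in X in _ -> X]eq_bigr do rewrite mulr1.
  move: hV; rewrite mul1r addr0 /A; lra.
have l0 (a : R) : 0 <= a -> 0 <= cst (1 : R) a by rewrite /= ler01.
exists (B / 1), ((d%:R * `|ln delta| + A + \int[mu]_x 0) / 1) => f fadm.
have := le_Ent mu_density V1 cX_ cY_ pX (measurable_cst (1 : R)) l0 i0 delta0 ltr01 B0 core fadm.
by under [X in (_ <= _ + _ * X)%E]eq_integral do rewrite /= mulr1; rewrite addeC.
Qed.

(** Divided by e^(-V), the divergence of C1 w x e^(-V) is C1 (<x, grad w> + d w - w <x, grad V>),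
    whose last term cancels the bound on w V. What remains is bounded coordinate by coordinate. *)
Lemma inequality_I_of_radial (alpha alphas eta eps C1 C2 : R) : (0 < d)%N ->
  1 < alpha <= 2 -> alpha^-1 + alphas^-1 = 1 -> 0 < eta ->
  (\int[mu]_x (expR (eta * enorm x `^ alpha))%:E < +oo)%E ->
  Ck 1 V -> (forall x, V x <= C1 * dotp x (grad V x) + C2) -> 0 < eps ->
  mu.-integrable setT (fun x => (expR (eps * enorm (grad V x)))%:E) ->
  inequality_I mu (2 / alphas).
Proof.
move=> d0 alpha12 conj eta0 moment V1 hV eps0 iV.
have /andP[alpha1 alpha2] := alpha12.
have [cV cV_ _] := Ck1_continuous V1.
have kappaE : 1 - 2 / alphas = 2 / alpha - 1 by lra.
pose l a := ln (expR 1 + a) `^ (2 / alpha - 1).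
have kappa0 : 0 <= 2 / alpha - 1.
  by rewrite subr_ge0 ler_pdivlMr ?mul1r// (lt_trans _ alpha1).
have l_ge1 a : 0 <= a -> 1 <= l a.
  by move=> a0; rewrite -[leLHS](powRr0 (ln (expR 1 + a))) ler_powR// ln_eD_ge1.
have le_l a b : 0 <= a -> a <= b -> l a <= l b.
  move=> a0 ab; have b0 := le_trans a0 ab.
  apply: ge0_ler_powR; rewrite ?nnegrE ?(le_trans ler01 (ln_eD_ge1 _))//.
  by rewrite ler_ln ?posrE ?ltr_wpDr ?expR_gt0// lerD2l.
(* Summed over the d coordinates, delta w |grad V| becomes a quarter of w eps |grad V|, which
   [young_entropy] trades for a quarter of w ln w and of the exponential moment. *)
pose delta := eps / (4 * d%:R).
pose c0 := (2 / eta) `^ (2 / alpha); pose k1 := 1 + 16 / eta ^+ 2.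
(* Chosen so that lam c0 = 1/4: the |x|^2 term costs another quarter of the entropy, and the
   coefficient 1/2 is left. *)
pose lam := (4 * c0)^-1.
have dR0 : 0 < d%:R :> R by rewrite ltr0n.
have delta0 : 0 < delta by apply: divr_gt0 => //; exact: mulr_gt0.
have c00 : 0 < c0 by apply: powR_gt0; exact: divr_gt0.
have lam0 : 0 < lam by rewrite invr_gt0 mulr_gt0.
pose A := `|C2| + d%:R * (5 * `|C1| + 5 * delta).
pose B := C1 ^+ 2 / lam + delta.
have B0 : 0 < B by apply: ltr_wpDl => //; rewrite divr_ge0 ?sqr_ge0// ltW.
pose E1 (x : 'rV[R]_d) := expR (eta * enorm x `^ alpha).
pose E2 (x : 'rV[R]_d) := expR (eps * enorm (grad V x)).
pose K x := lam * k1 * E1 x + (expR 1 / 4 + 4^-1 * E2 x).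
have iE1 : mu.-integrable setT (EFin \o E1).
  apply/integrableP; split.
    apply/measurable_EFinP; apply: measurableT_comp => //.
    apply: measurable_funM => //; apply: (measurableT_comp (measurable_powR alpha)).
    have ms : measurable_fun setT (@Num.sqrt R).
      by apply: continuous_measurable_fun; exact: sqrt_continuous.
    exact: (measurableT_comp ms (continuous_measurable_rV (@continuous_dotp _ _))).
  by under eq_integral do rewrite gee0_abs ?lee_fin ?expR_ge0//.
have iK : mu.-integrable setT (EFin \o K).
  have i1 : mu.-integrable setT (EFin \o (fun x => lam * k1 * E1 x)).
    by under [EFin \o _]eq_fun do rewrite /= EFinM; exact: integrableZl.
  have i2 : mu.-integrable setT (EFin \o (fun x => 4^-1 * E2 x)).
    by under [EFin \o _]eq_fun do rewrite /= EFinM; exact: integrableZl.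
  have i3 := integrableD measurableT
    (finite_measure_integrable_cst mu (expR 1 / 4) measurableT) i2.
  exact: (integrableD measurableT i1 i3).
pose X_ (i : 'I_d) (x : 'rV[R]_d) := C1 * x ord0 i.
have cX_ i : continuous (X_ i).
  by apply: continuous_mul; [exact: continuous_cst|exact: continuous_coord].
have cY_ (i : 'I_d) : continuous (fun _ : 'rV[R]_d => C1) by exact: continuous_cst.
have pX i : is_partial i (X_ i) (fun=> C1).
  apply: (is_partial_eq (is_partialM (is_partial_cst i C1) (is_partial_coord i i))) => x //.
  by rewrite mul0r add0r eqxx mulr1.
have core (x : 'rV[R]_d) (F theta : R) (G g : 'I_d -> R) :
    0 <= theta <= 1 -> (forall i, g i ^+ 2 <= 16 * theta) ->
    (forall i, `|x ord0 i * g i| <= 4) ->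
    let w := theta * F ^+ 2 in
    let w_ i := g i * F ^+ 2 + theta * (2 * F * G i) in
    2^-1 * (w * ln w) - (A * F ^+ 2 + B * (\sum_i G i ^+ 2 * l (F ^+ 2)) + K x) <=
    w * ln w - w * V x - delta * (\sum_i `|w_ i - w * partial i V x|) -
    \sum_i (w_ i * X_ i x + w * C1 - w * X_ i x * partial i V x).
  move=> t01 gt xg; have /andP[th0 th1] := t01.
  pose w := theta * F ^+ 2; pose w_ i := g i * F ^+ 2 + theta * (2 * F * G i).
  pose v i := partial i V x; pose L := l (F ^+ 2); pose D := enorm (grad V x).
  suff : 2^-1 * (w * ln w) - (A * F ^+ 2 + B * (\sum_i G i ^+ 2 * L) + K x) <=
    w * ln w - w * V x - delta * (\sum_i `|w_ i - w * v i|) -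
    \sum_i (w_ i * X_ i x + w * C1 - w * X_ i x * v i) by [].
  have F20 : 0 <= F ^+ 2 := sqr_ge0 F.
  have w0 : 0 <= w by rewrite mulr_ge0.
  have wF : w <= F ^+ 2 by rewrite ler_piMl.
  have L1 : 1 <= L by exact: l_ge1.
  have vD i : `|v i| <= D.
    rewrite -(@ler_pXn2r _ 2) ?nnegrE ?sqrtr_ge0// real_normK ?num_real//.
    rewrite enorm_sqr (bigD1 i)//= mxE lerDl sumr_ge0// => j _; exact: sqr_ge0.
  have hwV : w * V x <= C1 * (\sum_i w * (x ord0 i * v i)) + `|C2| * F ^+ 2.
    apply: (@le_trans _ _ (w * (C1 * dotp x (grad V x) + C2))); first exact: ler_wpM2l.
    rewrite mulrDr; apply: lerD; last first.
      by rewrite mulrC (le_trans (ler_wpM2r w0 (ler_norm _)))// ler_wpM2l.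
    rewrite mulrCA [w * _](_ : _ = \sum_i w * (x ord0 i * v i))//.
    by rewrite /dotp mulr_sumr; apply: eq_bigr => i _; rewrite mxE.
  have term i : C1 * (w_ i * x ord0 i) + w * C1 + delta * `|w_ i - w * v i| <=
      (5 * `|C1| + 5 * delta) * F ^+ 2 + B * (G i ^+ 2 * L) +
      (lam * (w * (x ord0 i ^+ 2 / L)) + delta * (w * D)).
    have h1 := @le_coord_partial _ _ _ F (G i) t01 (x ord0 i) L lam C1 (xg i) L1 lam0.
    have h2 : w * C1 <= `|C1| * F ^+ 2.
      by rewrite mulrC (le_trans (ler_wpM2r w0 (ler_norm _)))// ler_wpM2l.
    have h3 : `|w_ i - w * v i| <= 5 * F ^+ 2 + G i ^+ 2 * L + w * D.
      apply: le_trans (ler_normB _ _) _; apply: lerD.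
        apply: le_trans (le_norm_partial F (G i) t01 (gt i)) _.
        by rewrite lerD2l ler_peMr// sqr_ge0.
      by rewrite normrM ger0_norm// ler_wpM2l.
    have := ler_wpM2l (ltW delta0) h3.
    rewrite /B; move: h1 h2; rewrite -/(w_ i) -/w; lra.
  have hx : w * (enorm x ^+ 2 / L) <= k1 * E1 x + c0 * (w * ln (expR 1 + w)).
    apply: le_trans (le_sqr_div_powR_ln alpha12 eta0 (sqrtr_ge0 _) w0).
    (* The weight [L] is taken at F^2, the scalar lemma at w; as w <= F^2 and [l] is nondecreasing,
       dividing by [L] gives less. *)
    rewrite ler_wpM2l// ler_wpM2l ?sqr_ge0// lef_pV2 ?posrE; last 2 first.
    - exact: lt_le_trans ltr01 L1.
    - exact: lt_le_trans ltr01 (l_ge1 _ w0).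
    exact: le_l.
  have hx' : lam * (w * (enorm x ^+ 2 / L)) <= lam * k1 * E1 x + 4^-1 * (w * ln w + expR 1).
    apply: le_trans (ler_wpM2l (ltW lam0) hx) _; rewrite mulrDr [lam * (k1 * _)]mulrA lerD2l.
    rewrite [lam * (c0 * _)]mulrA (_ : lam * c0 = 4^-1); last by rewrite /lam; field; rewrite gt_eqF.
    by rewrite ler_wpM2l// xln_eD_le.
  have hD : d%:R * (delta * (w * D)) <= 4^-1 * (w * ln w + E2 x).
    rewrite [leLHS](_ : _ = 4^-1 * (w * (eps * D))); last first.
      by rewrite /delta; field; rewrite gt_eqF.
    by rewrite ler_wpM2l// young_entropy.
  have := ler_sum (index_enum 'I_d) (P := xpredT) (fun i _ => term i).
  have sum_cst (z : R) : \sum_(i < d) z = d%:R * z.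
    by rewrite sumr_const card_ord mulr_natl.
  rewrite !big_split/= !sum_cst -!mulr_sumr.
  have -> : \sum_(i < d) x ord0 i ^+ 2 / L = enorm x ^+ 2 / L.
    by rewrite enorm_sqr mulr_suml.
  have -> : \sum_i w_ i * X_ i x = C1 * \sum_i w_ i * x ord0 i.
    by rewrite mulr_sumr; apply: eq_bigr => i _; rewrite /X_ mulrCA.
  rewrite sumrN.
  have -> : \sum_i w * X_ i x * v i = C1 * \sum_i w * (x ord0 i * v i).
    by rewrite mulr_sumr; apply: eq_bigr => i _; rewrite /X_; ring.
  move: hx' hD hwV; rewrite /K /A; lra.
have l0 (a : R) : 0 <= a -> 0 <= l a by move=> _; exact: powR_ge0.
have ml : measurable_fun setT l.
  have mD : measurable_fun setT (fun a : R => expR 1 + a) by exact: measurable_funD.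
  exact: (measurableT_comp (measurable_powR _) (measurableT_comp (@measurable_ln R) mD)).
have half0 : 0 < 2^-1 :> R by [].
exists ((d%:R * `|ln delta| + A + \int[mu]_x K x) / 2^-1), (B / 2^-1) => f fadm.
have := le_Ent mu_density V1 cX_ cY_ pX ml l0 iK delta0 half0 B0 core fadm.
by rewrite /l -kappaE.
Qed.

End parts.

(** The logarithmic factor is at least 1 once |grad V| > e; elsewhere the constant exp (eps e)
    dominates. *)
Lemma integrable_expR_enorm_grad (R : realType) (d : nat) (V : 'rV[R]_d -> R)
    (mu : probability 'rV[R]_d R) (p eps : R) : Ck 1 V -> 0 <= p -> 0 < eps ->
  mu.-integrable setT (fun x => (expR (eps * (enorm (grad V x) *
    logpow p (enorm (grad V x)))))%:E) ->
  mu.-integrable setT (fun x => (expR (eps * enorm (grad V x)))%:E).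
Proof.
move=> V1 p0 eps0 i1; have [_ cV_ _] := Ck1_continuous V1.
have i2 := integrableD measurableT i1
  (finite_measure_integrable_cst mu (expR (eps * expR 1)) measurableT).
apply: (le_integrable measurableT _ _ i2) => [|x _].
  apply/measurable_EFinP; apply: measurableT_comp => //; apply: measurable_funM => //.
  have ms : measurable_fun setT (@Num.sqrt R).
    by apply: continuous_measurable_fun; exact: sqrt_continuous.
  apply: (measurableT_comp ms); apply: continuous_measurable_rV.
  apply: continuous_sum => i; rewrite (_ : (fun x => _) =
      fun x => partial i V x * partial i V x); first exact: continuous_mul.
  by apply/funext => x; rewrite mxE.
rewrite /= !lee_fin (ger0_norm (expR_ge0 _)) ger0_norm ?addr_ge0 ?expR_ge0//.
set y := enorm _; have y0 : 0 <= y by exact: sqrtr_ge0.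
have [ye|ey] := leP y (expR 1).
  apply: ler_wpDl; first exact: expR_ge0.
  by rewrite ler_expR ler_pM2l.
apply: ler_wpDr; first exact: expR_ge0.
have y1 : 1 < y by rewrite (lt_trans _ ey)// expR_gt1.
rewrite ler_expR ler_pM2l// /logpow y1 ler_peMr//.
rewrite -[leLHS](powRr0 (ln y)) ler_powR//.
by rewrite -[leLHS](@expRK R) ler_ln ?posrE ?expR_gt0 ?(ltW ey)// (lt_trans ltr01).
Qed.

Theorem theorem5p27 (R : realType) (d : nat) (V : 'rV[R]_d -> R)
  (mu : probability 'rV[R]_d R) (alpha alphas eta : R)
  (d_gt0 : (0 < d)%N)
  (mu_density : forall A : set 'rV[R]_d, measurable A ->
    mu A = (\int[lebesgue_rV R d]_(x in A) (expR (- V x))%:E)%E)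
  (alpha_range : 1 < alpha <= 2)
  (alphas_conj : alpha^-1 + alphas^-1 = 1)
  (eta_gt0 : 0 < eta)
  (exp_moment :
    (\int[mu]_x (expR (eta * enorm x `^ alpha))%:E < +oo)%E) :
  (* a) *)
  (Ck 1 V ->
   (exists C1 C2 : R, forall x, V x <= C1 * dotp x (grad V x) + C2) ->
   (exists2 eps : R, 0 < eps & mu.-integrable setT
     (fun x => (expR (eps * (enorm (grad V x) *
       logpow alpha^-1 (enorm (grad V x)))))%:E)) ->
   (exists2 g : 'rV[R]_d -> R, mu.-integrable setT (fun x => (g x)%:E) &
     forall x, - V x <= g x) ->
   inequality_I mu (2 / alphas)) /\
  (* b) *)
  (alpha = 2 -> Ck 2 V ->
   (exists2 g : 'rV[R]_d -> R, mu.-integrable setT (fun x => (g x)%:E) &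
     forall x, - V x <= g x) ->
   (exists s0 t : R, [/\ 0 < s0, 0 < t < 1 &
     forall s, 0 < s < s0 -> exists C : R, forall x,
       s * V x <= (1 - t) * enorm (grad V x) ^+ 2 - laplacian V x + C]) ->
   defective_log_sobolev mu) /\
  (* b), in particular *)
  (alpha = 2 -> Ck 2 V ->
   (exists m : R, forall x, m <= V x) ->
   (exists s t C : R, [/\ 0 < s, 0 < t < 1 & forall x,
       s * V x <= (1 - t) * enorm (grad V x) ^+ 2 - laplacian V x + C]) ->
   defective_log_sobolev mu).
Proof.
have /andP[alpha1 alpha2] := alpha_range.
split; [|split].
- move=> V1 [C1 [C2 hV]] [eps eps0 iV] _.
  apply: (inequality_I_of_radial mu_density d_gt0 alpha_range alphas_conj eta_gt0
    exp_moment V1 hV eps0).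
  apply: integrable_expR_enorm_grad iV => //.
  by rewrite invr_ge0 ltW// (lt_trans ltr01).
- move=> _ V2 _ [s0 [t [s00 t01 hs]]].
  (* Any s in (0, s0) would do. *)
  have s2 : 0 < s0 / 2 < s0 by apply/andP; split; lra.
  have [C hC] := hs _ s2; have /andP[s20 _] := s2.
  exact: (log_sobolev_of_curvature mu_density V2 s20 t01 hC).
- move=> _ V2 _ [s [t [C [s0 t01 hC]]]].
  exact: (log_sobolev_of_curvature mu_density V2 s0 t01 hC).
Qed.
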